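(* Let $\Delta$ be a constant and let $\mathcal{G}$ be a class of graphs each of maximum degree at most $\Delta$. Then every $\textup{str-DNNF}(\land,r)$ refutation of an unsatisfiable Tseitin formula $T(G,c)$ with $G \in \mathcal{G}$ contains a str-DNNF of size at least $2^{\Omega(k)}\cdot \mathrm{poly}(1/n)$, where $k = tw(G)$ is the treewidth of $G$, $n = |\mathrm{var}(T(G,c))|$, and the constants hidden in the asymptotic notation depend only on the class $\mathcal{G}$ (not on the particular graph $G$ or charge function $c$).
   Context: Graphs are undirected, without self-loops, possibly with parallel edges. Tseitin formulas: given a graph $G=(V,E)$ and a charge function $c:V\to\{0,1\}$, associate a Boolean variable $x_e$ to each edge $e$. For $v\in V$ let $E(v)$ be the set of edges incident to $v$. The parity constraint $\chi_{v,c}$ is $\sum_{e\in E(v)} x_e \equiv c(v) \pmod 2$; it is encoded by the CNF $F_{v,c}$ consisting of the $2^{|E(v)|-1}$ clauses on all variables $\{x_e : e\in E(v)\}$ each of which excludes exactly one assignment violating the constraint. The Tseitin formula is the CNF $T(G,c)=\bigwedge_{v\in V}F_{v,c}$. DNNF: a Boolean circuit (DAG) whose leaves are labeled by literals or constants $0,1$, whose internal nodes are labeled $\lor$ or $\land$ and have fan-in 2, and in which the two inputs of every $\land$-node have disjoint sets of variables below them. Its size is its number of edges. A vtree for a variable set $X$ is a rooted binary tree whose leaves are in bijection with $X$; for a vtree node $t$, $\mathrm{var}(t)$ is the set of variables at leaves below $t$. A structured DNNF (str-DNNF) is a DNNF $\Sigma$ with a vtree $T$ and a map $\lambda$ from nodes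 of $\Sigma$ to nodes of $T$ such that: for every $\land$-node $s$ with inputs $s_0,s_1$, $\lambda(s)$ is internal and $\lambda(s_0),\lambda(s_1)$ lie in the subtrees of the two different children of $\lambda(s)$ respectively; for every $\lor$-node $s$ with inputs $s_0,s_1$, $\lambda(s)=\lambda(s_0)=\lambda(s_1)$; and the variables below $s$ are contained in $\mathrm{var}(\lambda(s))$. $\textup{Apply}(\Sigma_1,\Sigma_2,\land)$ denotes the standard algorithm that, given two str-DNNF respecting the same vtree, returns a str-DNNF respecting that vtree equivalent to $\Sigma_1\land\Sigma_2$, in time $O(|\Sigma_1|\cdot|\Sigma_2|)$. A $\textup{str-DNNF}(\land,r)$ compilation of a CNF formula $F$ is a sequence $\Sigma_1,\dots,\Sigma_N$ of str-DNNF with $\Sigma_N\equiv F$ such that for each $i$: either $\Sigma_i$ is equivalent to some clause of $F$; or $\Sigma_i=\textup{Apply}(\Sigma_j,\Sigma_k,\land)$ for some $j,k<i$ where $\Sigma_j,\Sigma_k$ respect the same vtree; or $\Sigma_i\equiv\Sigma_j$ for some $j<i$ where $\Sigma_i$ and $\Sigma_j$ respect different vtrees. A $\textup{str-DNNF}(\land,r)$ refutation is such a compilation of an unsatisfiable formula.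
   Formalization: The formal theorem assumes G is connected (a large grid plus a disjoint edge with charges 1, 0 has a constant-size refutation, so the claim fails without it) and n > 1 (for a single edge, all circuits can be single leaves of size 0). *)

(* Defs.v *)
From mathcomp Require Import all_boot all_order all_algebra.
From mathcomp Require Import boolp reals exp.

Set Implicit Arguments.
Unset Strict Implicit.
Unset Printing Implicit Defensive.

(** * Multigraphs and treewidth *)

(* Undirected, loopless, possibly with parallel edges. *)
Record mgraph := MGraph {
  vert : finType;
  edge : finType;
  ends : edge -> {set vert};
  endsP : forall e, #|ends e| = 2
}.

Definition inc (G : mgraph) (v : vert G) : {set edge G} :=
  [set e | v \in ends e].

Definition max_degree (G : mgraph) : nat := \max_(v : vert G) #|inc v|.

Definition adj (G : mgraph) : rel (vert G) :=
  [rel u v | [exists e : edge G, ends e == [set u; v]]].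

Definition connected_graph (G : mgraph) : Prop :=
  forall u v : vert G, connect (@adj G) u v.

(* In a symmetric irreflexive relation, [ucycle] also accepts the back-and-forth
   closed walks [:: s; t]; genuine cycles have at least three vertices. *)
Definition is_tree (T : finType) (r : rel T) : Prop :=
  [/\ symmetric r, irreflexive r, 0 < #|T|,
      forall s t, connect r s t
    & forall p : seq T, ucycle r p -> size p <= 2].

Definition tree_decomposition (G : mgraph) (T : finType) (r : rel T)
    (bag : T -> {set vert G}) : Prop :=
  [/\ is_tree r,
      forall v, exists t, v \in bag t,
      forall e : edge G, exists t, ends e \subset bag t
    & forall v s t, v \in bag s -> v \in bag t ->
        connect [rel a b | [&& r a b, v \in bag a & v \in bag b]] s t].

Definition has_width_le (G : mgraph) (k : nat) : Prop :=
  exists (T : finType) (r : rel T) (bag : T -> {set vert G}),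
    tree_decomposition r bag /\ forall t, #|bag t| <= k.+1.

Lemma has_width_le_exists (G : mgraph) : exists k, `[< has_width_le G k >].
Proof.
exists #|vert G|; apply/asboolP.
exists unit, (fun _ _ => false), (fun _ => setT); split; last first.
  by move=> t; rewrite cardsT leqnSn.
split.
- split => //; first by rewrite card_unit.
    by case; case.
  by case=> [|x [|y p]].
- by move=> v; exists tt; rewrite finset.in_setT.
- by move=> e; exists tt; exact: finset.subsetT.
- by move=> v [] [] _ _; exact: connect0.
Qed.

Definition treewidth (G : mgraph) : nat := ex_minn (has_width_le_exists G).

(** * CNF formulas and Tseitin formulas *)

Section CNF.
Variable X : finType.

Definition assignment := {ffun X -> bool}.

(* The literal (x, b) is satisfied exactly by the assignments mapping x to b. *)
Definition literal : finType := (X * bool)%type.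
Definition clause : finType := {set literal}.
Definition cnf : finType := {set clause}.

Definition clause_sat (a : assignment) (C : clause) : bool :=
  [exists l in C, a l.1 == l.2].

Definition cnf_sat (a : assignment) (F : cnf) : bool :=
  [forall C in F, clause_sat a C].

Definition unsatisfiable (F : cnf) : Prop := forall a, ~~ cnf_sat a F.

Definition cnf_vars (F : cnf) : {set X} :=
  [set x | [exists C in F, [exists b, (x, b) \in C]]].

(* The clause on the variables S whose only falsifying assignment of S is the
   restriction of a to S. *)
Definition excluding_clause (S : {set X}) (a : assignment) : clause :=
  [set (x, ~~ a x) | x in S].

End CNF.

Definition charge (G : mgraph) := vert G -> bool.

Definition parity_sat (G : mgraph) (c : charge G) (a : assignment (edge G))
    (v : vert G) : bool :=
  (\sum_(e in inc v) a e) == c v %[mod 2].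

(* Assignments that agree on E(v) yield the same clause, so this set has one
   clause for each violating assignment of E(v). *)
Definition vertex_cnf (G : mgraph) (c : charge G) (v : vert G) : cnf (edge G) :=
  [set excluding_clause (inc v) a
    | a in [pred a : assignment (edge G) | ~~ parity_sat c a v]].

Definition tseitin (G : mgraph) (c : charge G) : cnf (edge G) :=
  \bigcup_(v : vert G) vertex_cnf c v.

(** * DNNF *)

Inductive gate (X N : Type) : Type :=
| Lit of X & bool
| Const of bool
| And of N & N
| Or of N & N.
Arguments Lit {X N}.
Arguments Const {X N}.
Arguments And {X N}.
Arguments Or {X N}.

Definition inputs (X N : Type) (g : gate X N) : seq N :=
  match g with
  | And s0 s1 | Or s0 s1 => [:: s0; s1]
  | Lit _ _ | Const _ => [::]
  end.

Definition wire (X : Type) (N : finType) (g : N -> gate X N) : rel N :=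
  [rel s t | t \in inputs (g s)].

Definition gate_vars (X : finType) (N : Type) (h : gate X N) : {set X} :=
  if h is Lit x _ then [set x] else set0.

Definition vars_below (X N : finType) (g : N -> gate X N) (s : N) : {set X} :=
  \bigcup_(t | connect (wire g) s t) gate_vars (g t).

Record dnnf (X : finType) := DNNF {
  node : finType;
  gate_of : node -> gate X node;
  root : node;
  acyclic : forall s t, wire gate_of s t -> ~~ connect (wire gate_of) t s;
  decomposable : forall s s0 s1, gate_of s = And s0 s1 ->
    [disjoint vars_below gate_of s0 & vars_below gate_of s1]
}.
Arguments gate_of {X} d _.
Arguments root {X} d.

Definition dnnf_size (X : finType) (D : dnnf X) : nat :=
  \sum_(s : node D) size (inputs (gate_of D s)).

(* Gates are monotone above the leaves, so the value 1 at a node can be given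
   inductively along the DAG. *)
Inductive true_at (X : finType) (D : dnnf X) (a : assignment X) :
    node D -> Prop :=
| TrueLit s x : gate_of D s = Lit x (a x) -> true_at a s
| TrueConst s : gate_of D s = Const true -> true_at a s
| TrueAnd s s0 s1 : gate_of D s = And s0 s1 ->
    true_at a s0 -> true_at a s1 -> true_at a s
| TrueOrL s s0 s1 : gate_of D s = Or s0 s1 -> true_at a s0 -> true_at a s
| TrueOrR s s0 s1 : gate_of D s = Or s0 s1 -> true_at a s1 -> true_at a s.

Definition accepts (X : finType) (D : dnnf X) (a : assignment X) : Prop :=
  true_at a (root D).

(** * Vtrees and structured DNNF *)

Inductive vtree (X : Type) : Type :=
| VLeaf of X
| VNode of vtree X & vtree X.
Arguments VLeaf {X}.
Arguments VNode {X}.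

Fixpoint vvars (X : Type) (t : vtree X) : seq X :=
  match t with
  | VLeaf x => [:: x]
  | VNode l r => vvars l ++ vvars r
  end.

(* When the leaves carry distinct variables, distinct nodes root distinct
   subtrees; a node is therefore represented by the subtree it roots. *)
Fixpoint vnode_of (X : Type) (u t : vtree X) : Prop :=
  u = t \/ match t with
           | VLeaf _ => False
           | VNode l r => vnode_of u l \/ vnode_of u r
           end.

(* Vtrees are unordered: the two children of a node may be exchanged. *)
Fixpoint same_vtree (X : eqType) (t u : vtree X) : bool :=
  match t, u with
  | VLeaf x, VLeaf y => x == y
  | VNode l r, VNode l' r' =>
      (same_vtree l l' && same_vtree r r') ||
      (same_vtree l r' && same_vtree r l')
  | _, _ => false
  end.

Record strdnnf (X : finType) := StrDNNF {
  circuit :> dnnf X;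
  vtree_of : vtree X;
  vtree_uniq : uniq (vvars vtree_of);
  lam : node circuit -> vtree X;
  lam_node : forall s, vnode_of (lam s) vtree_of;
  lam_and : forall s s0 s1, gate_of circuit s = And s0 s1 ->
    exists l r, lam s = VNode l r /\
      ((vnode_of (lam s0) l /\ vnode_of (lam s1) r) \/
       (vnode_of (lam s0) r /\ vnode_of (lam s1) l));
  lam_or : forall s s0 s1, gate_of circuit s = Or s0 s1 ->
    lam s = lam s0 /\ lam s = lam s1;
  lam_vars : forall s, {subset vars_below (gate_of circuit) s <= vvars (lam s)}
}.
Arguments vtree_of {X}.

(** * Bottom-up compilation *)

(* The successors account for circuits that are a single leaf, hence have no
   edge. *)
Definition is_apply (X : finType)
    (apply : strdnnf X -> strdnnf X -> strdnnf X) : Prop :=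
  exists A : nat, forall S1 S2 : strdnnf X,
    same_vtree (vtree_of S1) (vtree_of S2) ->
    [/\ same_vtree (vtree_of (apply S1 S2)) (vtree_of S1),
        forall a, accepts (apply S1 S2) a <-> accepts S1 a /\ accepts S2 a
      & dnnf_size (apply S1 S2) <= A * ((dnnf_size S1).+1 * (dnnf_size S2).+1)].

Definition compilation (X : finType)
    (apply : strdnnf X -> strdnnf X -> strdnnf X) (F : cnf X)
    (N : nat) (Sg : 'I_N.+1 -> strdnnf X) : Prop :=
  (forall a, accepts (Sg ord_max) a <-> cnf_sat a F) /\
  forall i : 'I_N.+1,
    [\/ exists2 C, C \in F & forall a, accepts (Sg i) a <-> clause_sat a C,
        exists j k : 'I_N.+1,
          [/\ j < i, k < i, same_vtree (vtree_of (Sg j)) (vtree_of (Sg k))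
            & Sg i = apply (Sg j) (Sg k)]
      | exists j : 'I_N.+1,
          [/\ j < i, ~~ same_vtree (vtree_of (Sg i)) (vtree_of (Sg j))
            & forall a, accepts (Sg i) a <-> accepts (Sg j) a]].

Definition refutation (X : finType)
    (apply : strdnnf X -> strdnnf X -> strdnnf X) (F : cnf X)
    (N : nat) (Sg : 'I_N.+1 -> strdnnf X) : Prop :=
  unsatisfiable F /\ compilation apply F Sg.

(* Main.v *)
Require Import Defs.
From mathcomp Require Import all_boot all_order all_algebra.
From mathcomp Require Import boolp reals exp.
From mathcomp Require Import zify.

(** Consider the first unsatisfiable circuit of the refutation. It is the
    conjunction of two satisfiable circuits D1 and D2 over the same vtree,
    equivalent to sets H1 and H2 of clauses whose union is unsatisfiable. As G
    is connected, D_i has a model x_i violating the parity at a single vertex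
    v_i.

    Fix a vtree node, hence a cut (Y, Y^c) of the edges. A vertex w with an edge
    e in Y and an edge f outside Y that lie on a common cycle avoiding v_1, v_2
    and the vertices treated before yields a branching: shift x_1 and x_2 along
    the cycle or not. Exchanging the two branches across the cut falsifies the
    clause of w that excludes x_1 + e, and this clause is in H1 or in H2.
    Iterating 2q times gives fooling sets M1 for D1 and M2 for D2 with
    |M1||M2| >= 2^(2q), whereas the circuit restricted to the cut is a union of
    about |D_i| rectangles, so |D1| or |D2| is about 2^q.

    If for every vtree node the branching stopped early, deleting few vertices
    would leave no bichromatic cycle in the large block singled out by a haven
    (which large treewidth provides, through a set without balanced separators).
    Each vtree node would then be oriented towards the side containing that
    block; the root contains it, the leaves do not, and at the node where the
    orientation changes the three deletions together give a contradiction. *)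

Set Implicit Arguments.
Unset Strict Implicit.
Unset Printing Implicit Defensive.

(** * Edge chains *)

Local Notation "\addb_ ( i | P ) F" := (\big[addb/false]_(i | P) F)
  (at level 41, F at level 41, i at level 50).

Section Chains.
Variable G : mgraph.
Implicit Types (x y z : assignment (edge G)) (u v w : vert G) (e f : edge G).
Implicit Types (S X Y : {set vert G}).

(** Assignments double as edge chains over the two-element field: [flip] is their sum, [boundary] is
    the boundary map, and a Tseitin constraint prescribes the boundary at one vertex. *)
Definition flip x z : assignment (edge G) := [ffun e => x e (+) z e].

Definition boundary z v : bool := \addb_(e | v \in ends e) z e.

Definition within X : rel (vert G) :=
  [rel u v | [&& @adj G u v, u \in X & v \in X]].

Definition edge_chain e0 : assignment (edge G) := [ffun e => e == e0].

Definition empty_chain : assignment (edge G) := [ffun => false].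

Lemma flipE x z e : flip x z e = x e (+) z e.
Proof. by rewrite ffunE. Qed.

Lemma parity_satE (c : charge G) x v :
  parity_sat c x v = (boundary x v == c v).
Proof.
rewrite /parity_sat !modn2.
have -> : odd (\sum_(e in inc v) x e) = boundary x v.
  rewrite (big_morph odd oddD (erefl : odd 0 = false)).
  by apply: eq_big => [e|e _]; rewrite ?inE // oddb.
by rewrite oddb; case: (boundary x v); case: (c v).
Qed.

Lemma boundary_flip x z v :
  boundary (flip x z) v = boundary x v (+) boundary z v.
Proof. by rewrite /boundary -big_split; apply: eq_bigr => e _; rewrite ffunE. Qed.

Lemma eq_boundary x y v : {in inc v, x =1 y} -> boundary x v = boundary y v.
Proof. by move=> xy; apply: eq_bigr => e ve; rewrite xy // inE. Qed.

Lemma boundary0 z v : (forall e, v \in ends e -> z e = false) ->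
  boundary z v = false.
Proof. by move=> z0; apply: big1 => e /z0. Qed.

Lemma boundary_edge e v : boundary (edge_chain e) v = (v \in ends e).
Proof.
rewrite /boundary; have [ve|ve] := boolP (v \in ends e).
  rewrite (bigD1 e) //= ffunE eqxx big1 => // f /andP[_ /negbTE fe].
  by rewrite ffunE fe.
apply: big1 => f vf; rewrite ffunE.
by apply/eqP => fe; rewrite -fe vf in ve.
Qed.

(** Once the sums are exchanged, each edge contributes at its two ends and these contributions
    cancel. *)
Lemma handshake z : \addb_(v | true) boundary z v = false.
Proof.
rewrite /boundary (exchange_big_dep xpredT) //=; apply: big1 => e _.
have /cards2P[u [v [uv ->]]] : #|ends e| == 2 by rewrite endsP.
rewrite (bigD1 u) /= ?in_set2 ?eqxx // (bigD1 v) /=.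
  rewrite big1 ?addbF ?addbb // => w /andP[/andP[]].
  by rewrite in_set2 => /orP[]/eqP->; rewrite eqxx ?andbF.
by rewrite in_set2 eqxx orbT eq_sym.
Qed.

Lemma adj_sym u v : @adj G u v = @adj G v u.
Proof. by rewrite /adj /=; apply: eq_existsb => e; rewrite setUC. Qed.

Lemma within_sym X : symmetric (within X).
Proof. by move=> u v; rewrite /within /= adj_sym [(v \in X) && _]andbC. Qed.

Lemma connect_within_sym X : connect_sym (within X).
Proof. exact/sym_connect_sym/within_sym. Qed.

Lemma connect_withinS X Y u v :
  X \subset Y -> connect (within X) u v -> connect (within Y) u v.
Proof.
move=> /subsetP XY; apply: connect_sub => a b /and3P[ab aX bX].
by apply: connect1; rewrite /within /= ab !XY.
Qed.

Lemma connect_stable (r : rel (vert G)) X u v : {in X, forall a b, r a b -> b \in X} ->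
  u \in X -> connect r u v -> v \in X.
Proof.
move=> clX uX /connectP[p pth ->] {v}.
elim: p u uX pth => //= b p IH a aX /andP[ab pth].
by apply: IH pth; exact: clX ab.
Qed.

Lemma adj_other e u : u \in ends e -> exists2 v, ends e = [set u; v] & u != v.
Proof.
have /cards2P[a [b [ab ->]]] : #|ends e| == 2 by rewrite endsP.
rewrite in_set2 => /orP[]/eqP->; first by exists b.
by exists a; rewrite 1?setUC 1?eq_sym.
Qed.

Lemma path_join X u v : connect (within X) u v ->
  exists2 z : assignment (edge G), forall e, z e -> ends e \subset X
  & forall w, boundary z w = (w == u) (+) (w == v).
Proof.
move=> /connectP[p]; elim: p u => /= [|a p IH] u.
  move=> _ ->; exists empty_chain => [e|w]; first by rewrite ffunE.
  by rewrite addbb boundary0 // => e; rewrite ffunE.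
case/andP=> /and3P[/existsP[e /eqP ee] uX aX] pth lst.
have [z zX zb] := IH _ pth lst.
exists (flip z (edge_chain e)) => [f|w].
  rewrite !ffunE; have [->|_] := eqVneq f e; last by rewrite addbF => /zX.
  by move=> _; rewrite ee subUset !sub1set uX.
have ua : u != a.
  by apply/eqP => ua; have := endsP e; rewrite ee ua setUid cards1.
rewrite boundary_flip boundary_edge zb ee in_set2.
have [->|_] := eqVneq w u; last by rewrite addbC addKb.
by rewrite (negbTE ua) addbC.
Qed.

(** Every vertex of [d] is joined to one root [x0] and the walks are added; as [d] is even, their
    contributions at [x0] cancel. *)
Lemma T_join X (d : pred (vert G)) :
  {in X &, forall u v, connect (within X) u v} ->
  (forall v, d v -> v \in X) -> \addb_(v | true) d v = false ->
  exists2 z : assignment (edge G), forall e, z e -> ends e \subset X & boundary z =1 d.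
Proof.
move=> conX dX d0.
have [x0 x0X|X0] := pickP (mem X); last first.
  have dF v : d v = false by apply/negP => /dX; rewrite [_ \in X]X0.
  exists empty_chain => [e|v]; first by rewrite ffunE.
  by rewrite dF boundary0 // => e; rewrite ffunE.
have /choice[zf zfP] : forall u, exists z : assignment (edge G), d u ->
    (forall e, z e -> ends e \subset X) /\
    (forall w, boundary z w = (w == u) (+) (w == x0)).
  move=> u; case du: (d u); last by exists empty_chain.
  by have [z zX zb] := path_join (conX _ _ (dX _ du) x0X); exists z.
exists [ffun e => \addb_(u | d u) zf u e] => [e|v].
  rewrite ffunE => ze; apply/contraT => neX; move: ze.
  by rewrite big1 // => u du; apply: contraNF neX; exact: (zfP _ du).1.
rewrite /boundary; under eq_bigr do rewrite ffunE.
rewrite exchange_big /=.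
under eq_bigr => u du do rewrite -/(boundary (zf u) v) (zfP _ du).2.
rewrite big_split /=.
have -> : \addb_(u | d u) (v == x0) = false.
  case: (v == x0); last by rewrite big1.
  by rewrite -[RHS]d0 [LHS]big_mkcond; apply: eq_bigr => u _; case: (d u).
rewrite addbF; have [dv|dv] := boolP (d v).
  by rewrite (bigD1 v) //= eqxx big1 // => u /andP[_ /negbTE]; rewrite eq_sym.
by rewrite big1 // => u du; apply: contraNF dv => /eqP->.
Qed.

End Chains.

(** * Tree decompositions *)

Section RootedTrees.
Variables (T : finType) (par : T -> T) (rank : T -> nat) (rt : T).
Hypothesis rank_par : forall a, a != rt -> rank (par a) < rank a.

(** Trees are given by parent pointers along which a rank decreases; the parent of the root [rt] is
    ignored. *)
Definition tree_edge : rel T :=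
  [rel a b | (a != rt) && (par a == b) || (b != rt) && (par b == a)].

Lemma tree_edge_sym : symmetric tree_edge.
Proof. by move=> a b; rewrite /tree_edge /= orbC. Qed.

Lemma tree_edge_below a b : tree_edge a b -> rank b <= rank a -> b = par a.
Proof.
case/orP=> /andP[nrt /eqP <-] //= le.
by have := rank_par nrt; rewrite ltnNge le.
Qed.

Lemma rooted_is_tree : is_tree tree_edge.
Proof.
have to_root a : connect tree_edge a rt.
  have [n] := ubnP (rank a); elim: n a => // n IH a lt_n.
  have [->|nrt] := eqVneq a rt; first exact: connect0.
  apply: connect_trans (IH (par a) _); last exact: leq_trans (rank_par nrt) _.
  by apply: connect1; rewrite /tree_edge /= nrt eqxx.
split.
- exact: tree_edge_sym.
- by move=> a; apply/negP => /orP[]/andP[/rank_par lt /eqP pa]; rewrite pa ltnn in lt.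
- by apply/card_gt0P; exists rt.
- move=> s t; apply: connect_trans (to_root s) _.
  by rewrite (sym_connect_sym tree_edge_sym).
- (* Both neighbours on a cycle of a vertex of maximal rank are its parent. *)
  move=> p cp; rewrite leqNgt; apply/negP => sz.
  have [x0 x0p] : exists x, x \in p by case: p sz {cp} => // x p _; exists x; rewrite mem_head.
  have [x xp xmax] : exists2 x, x \in p & forall y, y \in p -> rank y <= rank x.
    by have [x xp xmax] := arg_maxnP rank x0p; exists x.
  have [i q def_q] := rot_to xp.
  have sz_q : 2 < size (x :: q) by rewrite -def_q size_rot.
  have q_max y : y \in q -> rank y <= rank x.
    by move=> yq; apply: xmax; rewrite -(mem_rot i) def_q inE yq orbT.
  have : ucycle tree_edge (x :: q) by rewrite -def_q rot_ucycle.
  case/andP=> cyc unq; case: q {def_q} sz_q q_max cyc unq => [|y q] //.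
  case/lastP: q => [|q z] // _ q_max /=.
  rewrite rcons_path last_rcons => /and3P[xy _ zx] /and3P[_ + _].
  have yE := tree_edge_below xy (q_max _ (mem_head _ _)).
  rewrite tree_edge_sym in zx.
  have zE : z = par x.
    by apply: tree_edge_below zx (q_max _ _); rewrite inE mem_rcons mem_head orbT.
  by rewrite yE zE mem_rcons mem_head.
Qed.

End RootedTrees.

Section Decompositions.
Variable G : mgraph.
Implicit Types (U Q S B C Z : {set vert G}) (u v x y : vert G).

(** Decompositions of the graph induced on [U], with an interface [Q] in the root bag for gluing.
    The bags containing [v] are connected because each of them, except one topmost bag, has a parent
    containing [v]. *)
Definition rooted_decomposition k U Q : Prop :=
  exists (T : finType) (par : T -> T) (rank : T -> nat) (rt : T)
    (bag : T -> {set vert G}),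
  [/\ forall a, a != rt -> rank (par a) < rank a,
      Q \subset bag rt,
      forall t, bag t \subset U /\ #|bag t| <= k,
      forall v, v \in U -> exists2 top, v \in bag top &
        forall s, v \in bag s -> s != top -> s != rt /\ v \in bag (par s)
    & forall e : edge G, ends e \subset U -> exists t, ends e \subset bag t].

Lemma rooted_decomposition_width k :
  rooted_decomposition k.+1 setT set0 -> has_width_le G k.
Proof.
move=> [T [par [rank [rt [bag [rk _ bags tops edges]]]]]].
exists T, (tree_edge par rt), bag; split; last by move=> t; have [] := bags t.
split; first exact: rooted_is_tree rk.
- by move=> v; have [t vt _] := tops v (finset.in_setT v); exists t.
- by move=> e; apply: edges; exact: finset.subsetT.
move=> v s t vs vt; have [top vtop topP] := tops v (finset.in_setT v).
set r := [rel a b | _].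
have r_sym : symmetric r.
  by move=> a b; rewrite /r /= tree_edge_sym; do 2 case: (v \in _).
have to_top a : v \in bag a -> connect r a top.
  have [n] := ubnP (rank a); elim: n a => // n IH a lt_n va.
  have [->|ntop] := eqVneq a top; first exact: connect0.
  have [nrt vpa] := topP _ va ntop.
  apply: connect_trans (IH (par a) _ vpa); last exact: leq_trans (rk _ nrt) _.
  by apply: connect1; rewrite /r /= /tree_edge /= nrt eqxx va vpa.
apply: connect_trans (to_top _ vs) _.
by rewrite (sym_connect_sym r_sym) to_top.
Qed.

Lemma single_bag k U Q : Q \subset U -> #|U| <= k -> rooted_decomposition k U Q.
Proof.
move=> QU Uk; exists unit, id, (fun _ => 0), tt, (fun _ => U); split=> //.
by move=> v vU; exists tt => // [[]].
Qed.

(** The second root becomes a child of the first. A vertex common to both parts lies in both root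
    bags, so the bags containing it stay connected. *)
Lemma glue_decompositions k U1 U2 Q1 Q2 :
  rooted_decomposition k U1 Q1 -> rooted_decomposition k U2 Q2 ->
  U1 :&: U2 \subset Q1 :&: Q2 ->
  (forall e : edge G, ends e \subset U1 :|: U2 ->
    ends e \subset U1 \/ ends e \subset U2) ->
  rooted_decomposition k (U1 :|: U2) Q1.
Proof.
move=> [T1 [p1 [k1 [r1 [b1 [rk1 root1 bags1 tops1 edges1]]]]]].
move=> [T2 [p2 [k2 [r2 [b2 [rk2 root2 bags2 tops2 edges2]]]]]].
move=> /subsetP U12 edgesU.
exists (T1 + T2)%type.
exists (fun a => match a with
  | inl a => inl (p1 a)
  | inr a => if a == r2 then inl r1 else inr (p2 a) end).
exists (fun a => match a with inl a => k1 a | inr a => (k1 r1 + k2 a).+1 end).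
exists (inl r1), (fun a => match a with inl a => b1 a | inr a => b2 a end).
split=> //.
- case=> a /=; first by move=> nrt; apply: rk1.
  move=> _; have [->|nrt] := eqVneq a r2; first by rewrite ltnS leq_addr.
  by rewrite ltnS ltn_add2l rk2.
- by case=> t; [have [sub le] := bags1 t | have [sub le] := bags2 t];
    split=> //; apply: subset_trans sub _; rewrite ?subsetUl ?subsetUr.
- move=> v; have [vU1 _|vU1] := boolP (v \in U1).
    have [top vtop topP] := tops1 v vU1; exists (inl top) => // -[] s vs.
      by move=> st; apply: topP.
    move=> _; split=> //; case: (eqVneq s r2) => [sr|nrt].
      have vU2 : v \in U2 by apply: (subsetP (bags2 s).1).
      apply: (subsetP root1).
      by have := U12 v; rewrite !inE vU1 vU2 => /(_ isT)/andP[].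
    have vU2 : v \in U2 by apply: (subsetP (bags2 s).1).
    have [top2 vtop2 topP2] := tops2 v vU2.
    have vr2 : v \in b2 r2.
      apply: (subsetP root2).
      by have := U12 v; rewrite !inE vU1 vU2 => /(_ isT)/andP[].
    have top2E : top2 = r2.
      apply/eqP/contraT; rewrite eq_sym => /(topP2 _ vr2)[].
      by rewrite eqxx.
    by apply: (topP2 _ vs _).2; rewrite top2E.
  rewrite !inE (negbTE vU1) /= => vU2.
  have [top vtop topP] := tops2 v vU2; exists (inr top) => // -[] s vs.
    by case/negP: vU1; apply: (subsetP (bags1 s).1).
  by move=> st; have [|nrt vp] := topP _ vs; rewrite ?(negbTE nrt).
- move=> e /edgesU[/edges1[t et]|/edges2[t et]]; first by exists (inl t).
  by exists (inr t).
Qed.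

(** * Balanced separators bound the treewidth *)

Definition component S x : {set vert G} := [set y | connect (within (~: S)) x y].

Lemma extend_set Q U n : Q \subset U -> #|Q| <= n -> n <= #|U| ->
  exists Q', [/\ Q \subset Q', Q' \subset U & #|Q'| = n].
Proof.
elim: n => [|n IH] QU.
  by rewrite leqn0 => /eqP Q0 _; exists Q.
rewrite leq_eqVlt => /orP[/eqP Qn _|]; first by exists Q.
move=> lt_Q lt_U; have [Q' [QQ' Q'U Q'n]] := IH QU lt_Q (ltnW lt_U).
have /subsetPn[x xU xQ'] : ~~ (U \subset Q').
  by apply: contraTN lt_U => /subset_leq_card; rewrite Q'n -leqNgt.
exists (x |: Q'); split; last by rewrite cardsU1 xQ' Q'n.
  by apply: subset_trans QQ' (subsetUr _ _).
by rewrite subUset sub1set xU.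
Qed.

Section Balanced.
Variable l : nat.
Hypothesis balanced : forall Q, #|Q| = (2 * l).+1 ->
  exists2 S : {set vert G}, #|S| <= l & forall x, x \notin S -> #|Q :&: component S x| <= l.

(** [Q] is padded to [Q'] with 2l+1 vertices, which [S] splits into shares of at most l. The root
    bag [B] is [Q'] together with [S :&: U]; each component [C] of the rest is decomposed
    recursively, with its neighbourhood [N] in [B] as interface. As [N] lies in [S] and one share of
    [Q'], it has at most 2l vertices. *)
Lemma balanced_decomposition U Q : Q \subset U -> #|Q| <= (2 * l).+1 ->
  rooted_decomposition (3 * l).+1 U Q.
Proof.
have [n] := ubnP #|U|; elim: n U Q => // n IHn U Q ltUn QU leQ.
have [leU|ltU] := leqP #|U| (3 * l).+1; first exact: single_bag.
have leU : (2 * l).+1 <= #|U| by lia.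
have {QU leQ leU} [Q' [QQ' Q'U cQ']] := extend_set QU leQ leU.
have [S leS compS] := balanced cQ'.
have [B defB] : exists B, B = Q' :|: S :&: U by exists (Q' :|: S :&: U).
have BU : B \subset U by rewrite defB subUset Q'U subsetIr.
have leB : #|B| <= (3 * l).+1.
  have : #|B| <= #|Q'| + #|S :&: U| by rewrite defB cardsU leq_subr.
  have : #|S :&: U| <= #|S| by rewrite subset_leq_card ?subsetIl.
  by lia.
have sub_QB : Q \subset B by rewrite defB; apply: subset_trans QQ' (subsetUl _ _).
(* [Z] is a union of components of [U :\: B]; they are attached below the root bag one at a time. *)
suffices main Z : Z \subset U :\: B ->
    (forall u v, u \in Z -> v \in U :\: B -> @adj G u v -> v \in Z) ->
    rooted_decomposition (3 * l).+1 (Z :|: B) B.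
  have := main (U :\: B) (subxx _) (fun u v _ vU _ => vU).
  have -> : (U :\: B) :|: B = U.
    apply/setP => v; rewrite in_setU in_setD.
    by have := subsetP BU v; case: (v \in B); case: (v \in U) => //= ->.
  move=> [T [par [rk [rt [bag [? rootB ? ? ?]]]]]].
  by exists T, par, rk, rt, bag; split=> //; apply: subset_trans rootB.
have [m] := ubnP #|Z|; elim: m Z => // m IHm Z ltZm ZU clZ.
have [->|[x xZ]] := set_0Vmem Z.
  by rewrite finset.set0U; apply: single_bag.
pose C := [set y | connect (within (U :\: B)) x y].
have xU : x \in U :\: B by apply: (subsetP ZU).
have CZ : C \subset Z.
  apply/subsetP => y; rewrite inE; apply: connect_stable xZ.
  by move=> a aZ b /and3P[ab _ bU]; exact: clZ ab.
have clC u v : u \in C -> v \in U :\: B -> @adj G u v -> v \in C.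
  rewrite [u \in C]inE [v \in C]inE => xu vU uv.
  apply: (connect_trans xu); apply: connect1; rewrite /within /= uv vU andbT /=.
  by apply: (subsetP ZU); apply: (subsetP CZ); rewrite inE.
pose N := [set v in B | [exists u in C, @adj G u v]].
have CB u : u \in C -> u \notin B.
  by move=> /(subsetP CZ)/(subsetP ZU); rewrite in_setD => /andP[].
have CU : C \subset U.
  by apply/subsetP => u /(subsetP CZ)/(subsetP ZU); rewrite in_setD => /andP[].
have notS u : u \in U -> u \notin B -> u \notin S.
  by move=> uU; rewrite defB !in_setU in_setI uU andbT => /norP[].
have C_comp u : u \in C -> u \in component S x.
  rewrite !inE; apply: connect_withinS; apply/subsetP => v.
  by rewrite in_setD in_setC => /andP[vB vU]; apply: notS.
have N_comp v : v \in N -> v \notin S -> v \in component S x.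
  rewrite inE => /andP[vB /existsP[u /andP[uC uv]]] vS.
  have := C_comp u uC; rewrite !inE => xu; apply: (connect_trans xu); apply: connect1.
  by rewrite /within /= uv !in_setC vS andbT /= notS ?CB // (subsetP CU).
have NB : N \subset B by apply/subsetP => v; rewrite inE => /andP[].
have xS : x \notin S by apply: notS; move: xU; rewrite in_setD => /andP[].
have leSC : #|S| + #|Q' :&: component S x| <= 2 * l.
  by rewrite mul2n -addnn leq_add // compS.
(* [S] and one share of [Q'] have at most 2l vertices together, so some [q] in [Q'] is outside
   [C :|: N], and the recursive call is on a smaller set. *)
have [q qQ qSC] : exists2 q, q \in Q' & q \notin S :|: (Q' :&: component S x).
  apply/subsetPn; apply: contraTN leSC => sub.
  rewrite -ltnNge -cQ'; apply: leq_trans (subset_leq_card sub) _.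
  by rewrite cardsU leq_subr.
have CN_lt : #|C :|: N| < #|U|.
  apply/proper_card/properP; split.
    by rewrite subUset CU (subset_trans NB).
  exists q; first exact: (subsetP Q'U).
  move: qSC; rewrite !in_setU in_setI qQ /= => /norP[qS qC].
  apply/norP; split; first by apply: contra qC => /C_comp.
  by apply: contra qC => /N_comp->.
have leN : #|N| <= (2 * l).+1.
  have : N \subset S :|: (Q' :&: component S x).
    apply/subsetP => v vN; rewrite in_setU in_setI.
    have [//|vS] := boolP (v \in S); rewrite N_comp // andbT /=.
    by have := subsetP NB v vN; rewrite defB !in_setU in_setI (negbTE vS) orbF.
  move/subset_leq_card/leq_trans; apply; rewrite cardsU.
  exact: leq_trans (leq_subr _ _) (leqW leSC).
have xC : x \in C by rewrite inE.
have decC : rooted_decomposition (3 * l).+1 (C :|: N) N.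
  by apply: IHn; rewrite ?subsetUr //; apply: leq_trans CN_lt _.
have decZ : rooted_decomposition (3 * l).+1 (Z :\: C :|: B) B.
  apply: IHm.
  - apply: leq_trans (_ : #|Z| <= m); last by [].
    by apply/proper_card/properP; split; [exact: subsetDl|exists x; rewrite // in_setD xC].
  - by apply: subset_trans ZU; exact: subsetDl.
  - move=> u v; rewrite !in_setD => /andP[uC uZ] vU uv.
    rewrite (clZ u v) ?in_setD // andbT; apply: contra uC => vC.
    by apply: clC vC (subsetP ZU _ uZ) _; rewrite adj_sym.
have -> : Z :|: B = (Z :\: C :|: B) :|: (C :|: N).
  apply/setP => v; rewrite !in_setU in_setD.
  move: (introT implyP (subsetP CZ v)) (introT implyP (subsetP NB v)).
  by case: (v \in Z); case: (v \in B); case: (v \in C); case: (v \in N).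
apply: glue_decompositions decZ decC _ _.
  apply/subsetP => v; rewrite !(in_setI, in_setU, in_setD).
  move: (introT implyP (@CB v)) (introT implyP (subsetP NB v)).
  by case: (v \in Z); case: (v \in B); case: (v \in C); case: (v \in N).
move=> e eU.
have [a [b [ab eE]]] : exists a b, a != b /\ ends e = [set a; b].
  by apply/cards2P; rewrite endsP.
have adj_ab : @adj G a b by apply/existsP; exists e; rewrite eE.
have adj_ba : @adj G b a by rewrite adj_sym.
have step u v : u \in C -> v \in (Z :\: C :|: B) :|: (C :|: N) -> @adj G u v -> v \in C :|: N.
  move=> uC vU uv; rewrite in_setU; have [//|vC] := boolP (v \in C).
  have [vB|vB] := boolP (v \in B); first by rewrite inE vB; apply/existsP; exists u; rewrite uC.
  case/negP: vC; apply: clC uC _ uv; rewrite in_setD vB.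
  move: vU; rewrite !in_setU in_setD (negbTE vB) orbF /= => /orP[/andP[_]|/orP[]].
  - by move/(subsetP ZU); rewrite in_setD => /andP[].
  - by move/(subsetP CU).
  - by move/(subsetP NB); rewrite (negbTE vB).
move: eU; rewrite eE !subUset !sub1set => /andP[aU bU].
have [aC|aC] := boolP (a \in C).
  by right; rewrite (step a b) // andbT in_setU aC.
have [bC|bC] := boolP (b \in C).
  by right; rewrite (step b a) // in_setU bC.
have mem u : u \in (Z :\: C :|: B) :|: (C :|: N) -> u \notin C -> u \in Z :\: C :|: B.
  rewrite in_setU => /orP[//|]; rewrite in_setU => /orP[->//|uN] _.
  by rewrite in_setU (subsetP NB) ?orbT.
by left; rewrite !mem.
Qed.

Lemma balanced_width : has_width_le G (3 * l).
Proof.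
apply: rooted_decomposition_width; apply: balanced_decomposition.
  exact: sub0set.
by rewrite cards0.
Qed.

End Balanced.

Lemma treewidth_unbalanced l : 3 * l < treewidth G ->
  exists2 Q : {set vert G}, #|Q| = (2 * l).+1 &
    forall S : {set vert G}, #|S| <= l ->
      exists2 x, x \notin S & l < #|Q :&: component S x|.
Proof.
move=> lt_tw; apply: contrapT => noQ.
suff : has_width_le G (3 * l).
  move: lt_tw; rewrite /treewidth; case: ex_minnP => k _ min_k lt_k le_w.
  by have := min_k _ (asboolT le_w); rewrite leqNgt lt_k.
apply: balanced_width => Q cQ; apply: contrapT => noS; apply: noQ; exists Q => // S leS.
apply: contrapT => nox; apply: noS; exists S => // x xS.
by rewrite leqNgt; apply/negP => lt; apply: nox; exists x.
Qed.

End Decompositions.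

(** * Havens *)

Lemma cardsU1_le (T : finType) (S : {set T}) x : #|x |: S| <= #|S|.+1.
Proof. by rewrite cardsU1; case: (x \notin S); rewrite ?add1n ?add0n. Qed.

Section Havens.
Variable G : mgraph.
Implicit Types (S X Y Z N : {set vert G}) (u v w x y : vert G) (e f : edge G).

(** A haven of order l+1: for [S] of at most l vertices, [beta S] is a connected component of G - S,
    chosen monotonically in [S]. *)
Record haven (l : nat) (beta : {set vert G} -> {set vert G}) : Prop := Haven {
  haven_nonempty : forall S, #|S| <= l -> exists x, x \in beta S;
  haven_notin : forall S x, x \in beta S -> x \notin S;
  haven_closed : forall S x y,
    x \in beta S -> @adj G x y -> y \notin S -> y \in beta S;
  haven_connected : forall S x y, #|S| <= l ->
    x \in beta S -> y \in beta S -> connect (within (beta S)) x y;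
  haven_sub : forall S S', S \subset S' -> #|S'| <= l -> beta S' \subset beta S
}.

Lemma connect_within_closed X Y x y :
  {in X, forall a b, within Y a b -> b \in X} ->
  x \in X -> connect (within Y) x y -> connect (within X) x y.
Proof.
move=> clX xX /connectP[p pth ->].
elim: p x xX pth => [|b p IH] x xX /=; first by rewrite connect0.
case/andP=> xb pth; have bX := clX _ xX _ xb.
apply: connect_trans (IH _ bX pth); apply: connect1.
by case/and3P: xb => xb _ _; rewrite /within /= xb xX bX.
Qed.

(** [beta S] is the component of G - S holding more than half of an unbalanced set [Q] of 2l+1
    vertices. Two majorities intersect, so it is unique; shrinking [S] enlarges components, so it is
    monotone. *)
Lemma treewidth_haven l : 3 * l < treewidth G -> exists beta, haven l beta.
Proof.
move=> /treewidth_unbalanced[Q cQ compQ].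
pose beta S := [set y | (y \notin S) && (l < #|Q :&: component S y|)].
have comp_eq S x y : connect (within (~: S)) x y -> component S x = component S y.
  move=> xy; apply/setP => z; rewrite !inE.
  exact: (same_connect (connect_within_sym _)).
have cl S x y : x \in beta S -> @adj G x y -> y \notin S -> y \in beta S.
  rewrite !inE => /andP[xS lx] xy yS; rewrite yS -(comp_eq S x y) //.
  by apply: connect1; rewrite /within /= xy !in_setC xS.
exists beta; split=> //.
- by move=> S /compQ[x xS lx]; exists x; rewrite inE xS.
- by move=> S x; rewrite inE => /andP[].
- move=> S x y leS xb yb; apply: (@connect_within_closed _ (~: S)) => //.
    by move=> a ab b /and3P[adj_ab _]; rewrite in_setC; apply: cl adj_ab.
  move: xb yb; rewrite !inE => /andP[xS lx] /andP[yS ly].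
  have [z zx zy] : exists2 z, z \in component S x & z \in component S y.
    apply/exists_inP; rewrite -[X in is_true X]negbK negb_exists_in.
    apply/negP => /forall_inP dis.
    have : (Q :&: component S x) :&: (Q :&: component S y) = set0.
      apply/setP => z; rewrite !in_setI in_set0; apply/negP.
      by case/andP=> /andP[_ /dis/negP nz] /andP[_ /nz].
    move/eqP; rewrite -cards_eq0 => /eqP dis0.
    have : #|(Q :&: component S x) :|: (Q :&: component S y)| <= #|Q|.
      by apply: subset_leq_card; rewrite subUset !subsetIl.
    by rewrite cardsU dis0 cQ; lia.
  move: zx zy; rewrite !inE => xz yz; apply: connect_trans xz _.
  by rewrite connect_within_sym.
- move=> S S' SS' _; apply/subsetP => x; rewrite !inE => /andP[xS' lx].
  rewrite (contra (subsetP SS' x)) //=; apply: leq_trans lx (subset_leq_card _).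
  apply/setIS/subsetP => y; rewrite !inE; apply: connect_withinS.
  by rewrite setCS.
Qed.

(** * The core of a haven *)

Variables (l : nat) (beta : {set vert G} -> {set vert G}).
Hypothesis hb : haven l beta.

(* The block of G - S towards which the haven points: no single vertex separates
   its elements from the haven. *)
Definition core S := [set y in beta S | [forall x, (x != y) ==> (y \in beta (x |: S))]].

(** For [w] in [beta S]: the part of [beta S], including [w], that deleting [w] cuts off from the
    haven. *)
Definition hang S w := beta S :\: beta (w |: S).

Definition into S w e := [exists y in beta (w |: S), ends e == [set w; y]].

Lemma intoP S w e :
  reflect (exists2 y, y \in beta (w |: S) & ends e = [set w; y]) (into S w e).
Proof. by apply: (iffP exists_inP) => -[y yb /eqP ee]; exists y => //; apply/eqP. Qed.

Lemma coreP S y : reflect (y \in beta S /\ forall x, x != y -> y \in beta (x |: S))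
  (y \in core S).
Proof.
rewrite inE; apply: (iffP andP) => -[yb h]; split=> //.
  by move=> x; apply/implyP/(forallP h).
by apply/forallP => x; apply/implyP/h.
Qed.

Lemma core_beta S y : y \in core S -> y \in beta S.
Proof. by case/coreP. Qed.

Lemma core_sub S S' : S \subset S' -> #|S'| < l -> core S' \subset core S.
Proof.
move=> SS' leS'; apply/subsetP => y /coreP[yb h]; apply/coreP; split.
  exact: (subsetP (haven_sub hb SS' (ltnW leS'))).
move=> x /h; apply/subsetP/(haven_sub hb); first exact: setUS.
exact: leq_trans (cardsU1_le _ _) _.
Qed.

Lemma into_sub S S' w e : S \subset S' -> #|S'| < l -> into S' w e -> into S w e.
Proof.
move=> SS' leS' /intoP[y yb ee]; apply/intoP; exists y => //.
move: yb; apply/subsetP/(haven_sub hb); first exact: setUS.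
exact: leq_trans (cardsU1_le _ _) _.
Qed.

(** Otherwise [beta (x |: S)] would be closed under adjacency inside the connected set [beta S],
    hence contain [x]. *)
Lemma haven_neighbour S x : #|S| < l -> x \in beta S ->
  exists2 y, y \in beta (x |: S) & @adj G x y.
Proof.
move=> ltS xb; have lexS := leq_trans (cardsU1_le S x) ltS.
have [u ub] := haven_nonempty hb lexS.
apply: contrapT => noy.
have : x \in beta (x |: S).
  apply: (connect_stable (r := within (beta S)) _ ub); last first.
    apply: (haven_connected hb) => //; first exact: ltnW.
    exact: (subsetP (haven_sub hb (subsetUr _ _) lexS)).
  move=> a ab b /and3P[adj_ab _ bb]; apply: (haven_closed hb ab adj_ab).
  rewrite in_setU1 negb_or (haven_notin hb bb) andbT; apply/eqP => bx.
  by apply: noy; exists a; rewrite // -bx adj_sym.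
by move/(haven_notin hb); rewrite setU11.
Qed.

(** [beta (y |: S)] is connected, avoids [x], and meets [beta (x |: S)] in a vertex of
    [beta (x |: (y |: S))]. *)
Lemma haven_le S x y : #|S|.+1 < l -> x \notin beta (y |: S) ->
  beta (y |: S) \subset beta (x |: S).
Proof.
move=> ltS xb.
have lex := leq_trans (cardsU1_le S x) (ltnW ltS).
have ley := leq_trans (cardsU1_le S y) (ltnW ltS).
have lexy : #|x |: (y |: S)| <= l.
  apply: leq_trans (cardsU1_le _ _) _; apply: leq_trans ltS.
  by rewrite ltnS cardsU1_le.
have [u ub] := haven_nonempty hb lexy.
have uy : u \in beta (y |: S) by apply: (subsetP (haven_sub hb _ lexy)) ub; exact: subsetUr.
have ux : u \in beta (x |: S).
  by apply: (subsetP (haven_sub hb _ lexy)) ub; rewrite setUS // subsetUr.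
apply/subsetP => v vb.
apply: (connect_stable (r := within (beta (y |: S))) _ ux (haven_connected hb _ uy vb)) => //.
move=> a ab b /and3P[adj_ab _ bb]; apply: (haven_closed hb ab adj_ab).
have := haven_notin hb bb; rewrite !in_setU1 !negb_or => /andP[_ ->].
by rewrite andbT; apply: contraNneq xb => <-.
Qed.

Lemma haven_lt S x y : #|S|.+1 < l -> x != y -> y \in beta S ->
  x \notin beta (y |: S) -> #|beta (y |: S)| < #|beta (x |: S)|.
Proof.
move=> ltS xy yb xb; apply/proper_card/properP; split; first exact: haven_le.
have [z zb yz] := haven_neighbour (ltnW ltS) yb; exists y.
  apply: (haven_closed hb) (subsetP (haven_le ltS xb) _ zb) _ _.
    by rewrite adj_sym.
  by rewrite in_setU1 negb_or eq_sym xy (haven_notin hb yb).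
by apply/negP => /(haven_notin hb); rewrite setU11.
Qed.

(** A vertex [x] of [beta S] minimising [#|beta (x |: S)|] is in the core: a vertex of [beta S]
    separating it from the haven would give a smaller value by [haven_lt], and a vertex outside
    [beta S] separates nothing. *)
Lemma core_into S : #|S|.+1 < l -> exists w e, w \in core S /\ into S w e.
Proof.
move=> ltS; have [x0 x0b] := haven_nonempty hb (ltnW (ltnW ltS)).
have [x xb minx] : exists2 x, x \in beta S &
    forall y, y \in beta S -> #|beta (x |: S)| <= #|beta (y |: S)|.
  by have [x xb minx] := arg_minnP (fun x => #|beta (x |: S)|) x0b; exists x.
have [y yb /existsP[e /eqP ee]] := haven_neighbour (ltnW ltS) xb.
exists x, e; split; last by apply/intoP; exists y.
apply/coreP; split=> // z zx; apply: contraT => xz.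
have [zb|zb] := boolP (z \in beta S).
  by have := minx _ zb; rewrite leqNgt haven_lt // eq_sym.
have lez := leq_trans (cardsU1_le S z) (ltnW ltS).
have [u ub] := haven_nonempty hb lez.
case/negP: xz; apply: (connect_stable (r := within (beta S)) _ ub); last first.
  apply: (haven_connected hb) => //; first exact: ltnW (ltnW ltS).
  exact: (subsetP (haven_sub hb (subsetUr _ _) lez)).
move=> a ab b /and3P[adj_ab _ bb]; apply: (haven_closed hb ab adj_ab).
rewrite in_setU1 negb_or (haven_notin hb bb) andbT.
by apply: contraNneq zb => <-.
Qed.

Lemma path_avoid S x a p : path (within (beta S)) a p -> x \notin a :: p ->
  (a \in beta (x |: S)) = (last a p \in beta (x |: S)).
Proof.
elim: p a => //= b p IH a /andP[/and3P[ab aB bB] pth].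
rewrite inE negb_or => /andP[xa xp]; rewrite -IH //.
have xb : x != b by move: xp; rewrite inE negb_or => /andP[].
apply/idP/idP => h.
  apply: (haven_closed hb h ab).
  by rewrite in_setU1 negb_or eq_sym xb (haven_notin hb bB).
rewrite adj_sym in ab; apply: (haven_closed hb h ab).
by rewrite in_setU1 negb_or eq_sym xa (haven_notin hb aB).
Qed.

(** A simple path in [beta S] between core vertices stays in the core: a vertex [x] other than [y]
    lies on at most one of the two halves at [y], so [y] is linked to [u] or to [v] avoiding [x]. *)
Lemma core_connected S u v : #|S| <= l -> u \in core S -> v \in core S ->
  connect (within (core S)) u v.
Proof.
move=> leS uc vc.
have /connectP[p0 pth0 vE] := haven_connected hb leS (core_beta uc) (core_beta vc).
case/shortenP: pth0 vE => p pth unq _ {p0} vE.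
have inbeta y : y \in p -> y \in beta S.
  elim: p (u) pth {unq vE} => //= b p IH a /andP[/and3P[_ _ bb] pth].
  by rewrite inE => /orP[/eqP->//|]; apply: IH pth.
have incore y : y \in p -> y \in core S.
  move=> yp; apply/coreP; split; first exact: inbeta.
  move=> x xy; case/splitPr: p / yp pth unq vE {inbeta} => p1 p2 pth unq vE.
  have [xp1|xp1] := boolP (x \in u :: p1).
    rewrite cat_path /= in pth; case/and3P: pth => _ _ pth2.
    have xp2 : x \notin y :: p2.
      move: unq; rewrite -cat_cons cat_uniq => /and3P[_ /hasPn dis _].
      by apply/negP => /dis; rewrite xp1.
    have lE : last y p2 = v by rewrite vE last_cat.
    rewrite (path_avoid pth2 xp2) lE.
    apply: (coreP _ _ vc).2; apply: contraNneq xp2 => ->.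
    by rewrite -lE mem_last.
  have pth1 : path (within (beta S)) u (rcons p1 y).
    by move: pth; rewrite -cat_rcons cat_path => /andP[].
  have xp1' : x \notin u :: rcons p1 y.
    by rewrite -rcons_cons mem_rcons inE negb_or xy.
  have := path_avoid pth1 xp1'; rewrite last_rcons => <-.
  by apply: (coreP _ _ uc).2; apply: contraNneq xp1 => ->; rewrite mem_head.
rewrite vE; apply/connectP; exists p => //.
elim: p (u) uc pth {unq vE inbeta} incore => //= b p IH a ac /andP[/and3P[ab _ _] pth] inc.
have bc := inc b (mem_head _ _).
rewrite {1}/within /= ab ac bc IH //.
by move=> y yp; apply: inc; rewrite inE yp orbT.
Qed.

(** On a simple path from [y] to [w], either [w'] is absent and [y] is not cut off by [w'], or the
    segment up to [w'] avoids [w] and [y] is not cut off by [w]. *)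
Lemma hang_disjoint S w w' y : #|S| <= l -> w \in core S -> w' \in core S ->
  y \in hang S w -> y \in hang S w' -> w = w'.
Proof.
move=> leS wc w'c /setDP[yb yw] /setDP[_ yw']; apply/eqP/contraT => ww'.
have /connectP[p0 pth0 wE] := haven_connected hb leS yb (core_beta wc).
case/shortenP: pth0 wE => p pth unq _ {p0} wE.
have [w'p|w'p] := boolP (w' \in y :: p); last first.
  rewrite (path_avoid pth w'p) -wE in yw'; case/negP: yw'.
  by apply: (coreP _ _ wc).2; rewrite eq_sym.
case/predU1P: w'p => [w'y|w'p].
  by case/negP: yw; rewrite -w'y; apply: (coreP _ _ w'c).2.
case/splitPr: p / w'p pth unq wE => p1 p2 pth unq wE.
have pth1 : path (within (beta S)) y (rcons p1 w').
  by move: pth; rewrite -cat_rcons cat_path => /andP[].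
have wp1 : w \notin y :: rcons p1 w'.
  move: unq; rewrite -cat_rcons -cat_cons cat_uniq => /and3P[_ /hasPn dis _].
  apply: dis; move: wE; rewrite last_cat /=.
  by case: (p2) => [/= /eqP|b q /= ->]; rewrite ?(negbTE ww') // mem_last.
case/negP: yw; rewrite (path_avoid pth1 wp1) last_rcons.
exact: (coreP _ _ w'c).2.
Qed.

Lemma hang_meet_card S N : #|S| <= l ->
  #|[set w in core S | ~~ [disjoint hang S w & N]]| <= #|N|.
Proof.
move=> leS; set B := [set w in _ | _].
(* The pick succeeds for [w] in [B], so the default does not occur there. *)
pose g w := odflt w [pick y | (y \in hang S w) && (y \in N)].
have gP w : w \in B -> (g w \in hang S w) && (g w \in N).
  rewrite inE => /andP[_ ndis]; rewrite /g; case: pickP => //= none.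
  by case/negP: ndis; apply/pred0P => y; exact: none.
rewrite -(@card_in_imset _ _ g) => [|w w' wB w'B gE].
  by apply/subset_leq_card/subsetP => _ /imsetP[w /gP/andP[_ ?] ->].
have /andP[gw _] := gP w wB; have /andP[] := gP w' w'B; rewrite -gE => gw' _.
by apply: hang_disjoint leS _ _ gw gw'; [move: wB | move: w'B]; rewrite inE => /andP[].
Qed.

(* No cycle through the core changes sides of the cut Y at a vertex of the core. *)
Definition saturated (Y : {set edge G}) S :=
  forall w e f, w \in core S -> into S w e -> into S w f -> e \in Y -> f \in Y.

(** An edge between two core vertices leads into the haven from both of its ends, so its side of the
    cut propagates through the connected core. *)
Lemma saturated_side (Y : {set edge G}) S : #|S| < l -> saturated Y S ->
  (forall w e, w \in core S -> into S w e -> e \in Y) \/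
  (forall w e, w \in core S -> into S w e -> e \notin Y).
Proof.
move=> ltS sat.
have [[w0 [e0 [w0c e0i e0Y]]]|none] :=
  pselect (exists w e, [/\ w \in core S, into S w e & e \in Y]); last first.
  by right=> w e wc ei; apply/negP => eY; apply: none; exists w, e.
left=> w e wc ei.
pose X := [set w in core S | [forall e, into S w e ==> (e \in Y)]].
suff: w \in X by rewrite inE => /andP[_ /forallP/(_ e)/implyP]; exact.
have w0X : w0 \in X.
  rewrite inE w0c; apply/forallP => f; apply/implyP => fi.
  exact: sat w0c e0i fi e0Y.
apply: (connect_stable (r := within (core S)) _ w0X (core_connected (ltnW ltS) w0c wc)).
move=> a aX b /and3P[/existsP[h /eqP hE] ac bc].
have ab : a != b.
  by apply/eqP => ab; have := endsP h; rewrite hE ab setUid cards1.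
have hY : h \in Y.
  move: aX; rewrite inE => /andP[_ /forallP/(_ h)/implyP]; apply.
  by apply/intoP; exists b => //; apply: (coreP _ _ bc).2.
rewrite inE bc; apply/forallP => f; apply/implyP => fi.
apply: sat bc _ fi hY; apply/intoP; exists a; last by rewrite setUC.
by apply: (coreP _ _ ac).2; rewrite eq_sym.
Qed.

(** * Choosing a vtree node with an unsaturated cut *)

Lemma vnode_refl (X : Type) (t : vtree X) : vnode_of t t.
Proof. by case: t => *; left. Qed.

Lemma vnode_trans (X : Type) (r s t : vtree X) :
  vnode_of r s -> vnode_of s t -> vnode_of r t.
Proof.
move=> rs; elim: t => [x|a IHa b IHb] /=; first by case=> // sE; rewrite sE in rs.
case=> [sE|[/IHa h|/IHb h]]; [by rewrite sE in rs|by right; left|by right; right].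
Qed.

Lemma vnode_left (X : Type) (a b t : vtree X) :
  vnode_of (VNode a b) t -> vnode_of a t.
Proof. by apply: vnode_trans; right; left; exact: vnode_refl. Qed.

Lemma vnode_right (X : Type) (a b t : vtree X) :
  vnode_of (VNode a b) t -> vnode_of b t.
Proof. by apply: vnode_trans; right; right; exact: vnode_refl. Qed.

(** If every node had a small saturated set, induction on the vtree would keep the core edges
    outside [vvars t] for every node [t], even for the root, which contains all edges. *)
Lemma unsaturated_vnode (T : vtree (edge G)) l0 : 0 < l0 -> 3 * l0 + 2 <= l ->
  (forall e, e \in vvars T) ->
  exists2 t, vnode_of t T &
    forall S, #|S| <= l0 -> ~ saturated [set e in vvars t] S.
Proof.
move=> l0_gt0 lel fullT; apply: contrapT => nosplit.
have sat t : vnode_of t T -> exists2 S : {set vert G}, #|S| <= l0 & saturated [set e in vvars t] S.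
  move=> tT; apply: contrapT => nosat; apply: nosplit; exists t => // S leS satS.
  by apply: nosat; exists S.
have out t : vnode_of t T -> exists2 S : {set vert G}, #|S| <= l0 &
    forall w e, w \in core S -> into S w e -> e \notin vvars t.
  elim: t => [e0|a IHa b IHb] tT.
    have [u [v [_ ee]]] : exists u v, u != v /\ ends e0 = [set u; v].
      by apply/cards2P; rewrite endsP.
    (* Deleting one end of the edge at a leaf keeps that edge out of the core; this takes a set of
       size 1, hence [0 < l0]. *)
    exists [set u] => [|w e wc /intoP[y yb eE]]; first by rewrite cards1.
    rewrite inE; apply/eqP => ee0; move: eE; rewrite ee0 ee => /setP/(_ u).
    rewrite !in_set2 eqxx /= => /esym/orP[]/eqP uE.
      by have := haven_notin hb (core_beta wc); rewrite in_set1 uE eqxx.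
    by have := haven_notin hb yb; rewrite in_setU1 in_set1 uE eqxx orbT.
  have [S leS satS] := sat _ tT.
  have [Sa leSa outa] := IHa (vnode_left tT).
  have [Sb leSb outb] := IHb (vnode_right tT).
  have ltS : #|S| < l by lia.
  case: (saturated_side ltS satS) => [inS|outS]; last first.
    by exists S => // w e wc /(outS _ _ wc); rewrite inE.
  (* Three sets of size at most [l0] fit below [l] with the margin that [core_into] requires. A core
     edge for their union is one for each of them: it lies below the node but below neither
     child. *)
  pose S3 := S :|: (Sa :|: Sb).
  have leS3 : #|S3|.+1 < l.
    by rewrite /S3 !cardsU; lia.
  have [w [e [wc ei]]] := core_into leS3.
  have sub3 X : X \subset S3 -> w \in core X /\ into X w e.
    move=> XS; split; first exact: (subsetP (core_sub XS (ltnW leS3))).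
    exact: into_sub XS (ltnW leS3) ei.
  have [wS eS] := sub3 S (subsetUl _ _).
  have [wa ea] : w \in core Sa /\ into Sa w e.
    by apply: sub3; rewrite (subset_trans (subsetUl Sa Sb)) // subsetUr.
  have [wb eb] : w \in core Sb /\ into Sb w e.
    by apply: sub3; rewrite (subset_trans (subsetUr Sa Sb)) // subsetUr.
  have := inS _ _ wS eS; rewrite inE /= mem_cat.
  by rewrite (negbTE (outa _ _ wa ea)) (negbTE (outb _ _ wb eb)).
have [S leS outT] := out T (vnode_refl T).
have ltS : #|S|.+1 < l by lia.
by have [w [e [wc ei]]] := core_into ltS; have := outT _ _ wc ei; rewrite fullT.
Qed.

End Havens.

(** * Rectangle covers *)

Definition mix (X : finType) (Y : {set X}) (x y : assignment X) : assignment X :=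
  [ffun e => if e \in Y then x e else y e].

Section Rectangles.
Variables (X : finType) (D : dnnf X) (Y : {set X}).
Implicit Types (x y : assignment X) (s t : node D).

Local Notation vars := (vars_below (gate_of D)).
Local Notation reach := (connect (wire (gate_of D))).

(** Under this condition the part of a certificate that reads [Y] lies below a single node. *)
Definition decomposes_along : Prop := forall s s0 s1, gate_of D s = And s0 s1 ->
  [\/ vars s \subset Y, [disjoint vars s0 & Y] | [disjoint vars s1 & Y]].

Lemma vars_wire s t : wire (gate_of D) s t -> vars t \subset vars s.
Proof.
move=> st; apply/subsetP => e /bigcupP[r tr er]; apply/bigcupP; exists r => //.
exact: connect_trans (connect1 st) tr.
Qed.

Lemma vars_leaf s : inputs (gate_of D s) = [::] -> vars s = gate_vars (gate_of D s).
Proof.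
move=> leaf; apply/setP => e; apply/bigcupP/idP => [[t /connectP[[|r p]]]|es].
- by move=> _ ->.
- by rewrite /= /wire /= leaf.
- by exists s.
Qed.

Lemma true_at_ext x y s : true_at x s -> {in vars s, x =1 y} -> true_at y s.
Proof.
elim=> {s} [s e ge|s gs|s s0 s1 gs _ IH0 _ IH1|s s0 s1 gs _ IH|s s0 s1 gs _ IH] xy.
- apply: (@TrueLit _ _ _ _ e); rewrite -xy //.
  by rewrite vars_leaf ge // inE.
- exact: TrueConst.
- have sub t : t \in [:: s0; s1] -> {in vars t, x =1 y}.
    move=> ts e et; apply: xy; apply: (subsetP (vars_wire _)) et.
    by rewrite /wire /= gs.
  by apply: TrueAnd gs (IH0 _) (IH1 _); apply: sub; rewrite !inE eqxx ?orbT.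
- apply: (TrueOrL gs (IH _)) => e et; apply: xy; apply: (subsetP (vars_wire _)) et.
  by rewrite /wire /= gs inE eqxx.
- apply: (TrueOrR gs (IH _)) => e et; apply: xy; apply: (subsetP (vars_wire _)) et.
  by rewrite /wire /= gs !inE eqxx orbT.
Qed.

(** [None] is the key of certificates that read no variable of [Y]. *)
Definition key_true (k : option (node D)) x : Prop :=
  if k is Some u then true_at x u else True.

Definition key_in s (k : option (node D)) : bool :=
  if k is Some u then reach s u else true.

(* The key of a model is the node at which its certificate enters Y, so that
   models with the same key form a rectangle. *)
Lemma rectangle_key x s : decomposes_along -> true_at x s ->
  exists k, [/\ key_in s k, key_true k x
    & forall x', key_true k x' -> true_at (mix Y x' x) s].
Proof.
move=> dec xs.
have inside t : vars t \subset Y -> true_at x t ->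
    exists k, [/\ key_in t k, key_true k x
      & forall x', key_true k x' -> true_at (mix Y x' x) t].
  move=> tY xt; exists (Some t); split=> //= x' x't.
  by apply: true_at_ext x't _ => e /(subsetP tY) eY; rewrite ffunE eY.
have outside t x' : [disjoint vars t & Y] -> true_at x t -> true_at (mix Y x' x) t.
  move=> tY xt; apply: true_at_ext xt _ => e et.
  by rewrite ffunE (disjointFr tY et).
have up s' t k : t \in inputs (gate_of D s') -> key_in t k -> key_in s' k.
  case: k => //= u st tu; exact: connect_trans (connect1 st) tu.
elim: xs => {s} [s e ge|s gs|s s0 s1 gs x0 IH0 x1 IH1|s s0 s1 gs x0 IH|s s0 s1 gs x1 IH].
- have vs : vars s = [set e] by rewrite vars_leaf ge.
  have [eY|eY] := boolP (e \in Y).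
    by apply: inside; [rewrite vs sub1set|exact: TrueLit ge].
  exists None; split=> // x' _; apply: outside; last exact: TrueLit ge.
  by rewrite vs disjoints1.
- by exists None; split=> // x' _; apply: TrueConst.
- case: (dec _ _ _ gs) => dis; first exact: inside dis (TrueAnd gs x0 x1).
    have [k [kin kx kmix]] := IH1; exists k; split=> //.
      by apply: up kin; rewrite gs !inE eqxx orbT.
    by move=> x' kx'; apply: TrueAnd gs (outside _ _ dis x0) (kmix _ kx').
  have [k [kin kx kmix]] := IH0; exists k; split=> //.
    by apply: up kin; rewrite gs !inE eqxx.
  by move=> x' kx'; apply: TrueAnd gs (kmix _ kx') (outside _ _ dis x1).
- have [k [kin kx kmix]] := IH; exists k; split=> //.
    by apply: up kin; rewrite gs !inE eqxx.
  by move=> x' kx'; apply: TrueOrL gs (kmix _ kx').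
- have [k [kin kx kmix]] := IH; exists k; split=> //.
    by apply: up kin; rewrite gs !inE eqxx orbT.
  by move=> x' kx'; apply: TrueOrR gs (kmix _ kx').
Qed.

(** Each reachable node except the root is the target of a wire; the successor counts the root. *)
Lemma reachable_card : #|[set s | reach (Defs.root D) s]| <= (dnnf_size D).+1.
Proof.
have sub : [set s | reach (Defs.root D) s] \subset
    Defs.root D |: \bigcup_s [set t in inputs (gate_of D s)].
  apply/subsetP => s; rewrite inE in_setU1 => /connectP[p].
  case/lastP: p => [|p t]; first by move=> _ ->; rewrite eqxx.
  rewrite rcons_path last_rcons => /andP[_ pt ->]; apply/orP; right.
  by apply/bigcupP; exists (last (Defs.root D) p) => //; rewrite inE.
apply: leq_trans (subset_leq_card sub) _; apply: leq_trans (cardsU1_le _ _) _.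
rewrite ltnS /dnnf_size; elim/big_rec2: _ => [|s n A _ leA]; first by rewrite cards0.
have leU : #|[set t in inputs (gate_of D s)] :|: A| <= #|[set t in inputs (gate_of D s)]| + #|A|.
  by rewrite cardsU leq_subr.
apply: leq_trans leU _; apply: leq_add leA.
by rewrite cardsE card_size.
Qed.

(** Two models with the same key have both mixes accepted, so keys are injective on [M]. They are
    [None] or reachable nodes. *)
Lemma fooling_set_size (M : {set assignment X}) : decomposes_along ->
  (forall x, x \in M -> accepts D x) ->
  (forall x y, x \in M -> y \in M -> x != y ->
    ~ (accepts D (mix Y x y) /\ accepts D (mix Y y x))) ->
  #|M| <= (dnnf_size D).+2.
Proof.
move=> dec accM foolM.
have /choice[g gP] : forall x, exists k, x \in M ->
    [/\ key_in (Defs.root D) k, key_true k x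
      & forall x', key_true k x' -> accepts D (mix Y x' x)].
  move=> x; have [xM|_] := boolP (x \in M); last by exists None.
  by have [k kP] := rectangle_key dec (accM _ xM); exists k.
rewrite -(@card_in_imset _ _ g) => [|x y xM yM gE]; last first.
  apply/eqP/contraT => xy; case: (foolM x y xM yM xy).
  have [_ kx mx] := gP x xM; have [_ ky my] := gP y yM.
  by split; [apply: my; rewrite -gE | apply: mx; rewrite gE].
have sub : g @: M \subset None |: (Some @: [set s | reach (Defs.root D) s]).
  apply/subsetP => _ /imsetP[x xM ->]; have [+ _ _] := gP x xM.
  rewrite in_setU1; case: (g x) => //= u ru.
  by apply/imsetP; exists u; rewrite ?inE.
apply: leq_trans (subset_leq_card sub) _; apply: leq_trans (cardsU1_le _ _) _.
rewrite ltnS; apply: leq_trans reachable_card.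
exact: leq_imset_card.
Qed.

End Rectangles.

(** * Vtree nodes as cuts of structured circuits *)

Section Structured.
Variables (X : finType).

Lemma decomposes_along1 (D : dnnf X) e : decomposes_along D [set e].
Proof.
move=> s s0 s1 gs; have := decomposable gs.
have [e0 dis|e0 _] := boolP (e \in vars_below (gate_of D) s0).
  by apply: Or33; rewrite disjoint_sym disjoints1 (disjointFr dis e0).
by apply: Or32; rewrite disjoint_sym disjoints1.
Qed.

Lemma vvars_vnode (t T : vtree X) : vnode_of t T -> {subset vvars t <= vvars T}.
Proof.
elim: T => [x|a IHa b IHb] /=; first by case=> // ->.
by case=> [->//|[/IHa|/IHb] sub] e /sub et; rewrite mem_cat et ?orbT.
Qed.

(** Leaf sets of subtrees are laminar: [t] is above the node, disjoint from it, or within one child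
    and so disjoint from the other. *)
Lemma vvars_laminar (T t l r : vtree X) : uniq (vvars T) ->
  vnode_of t T -> vnode_of (VNode l r) T ->
  [\/ {subset vvars (VNode l r) <= vvars t},
      {in vvars l, forall e, e \notin vvars t}
    | {in vvars r, forall e, e \notin vvars t}].
Proof.
elim: T => [x|a IHa b IHb] /=; first by move=> _ _ [].
rewrite cat_uniq => /and3P[ua /hasPn disj ub].
have dis e : e \in vvars a -> e \in vvars b -> False.
  by move=> ea /disj; rewrite ea.
case=> [-> lrT|tT].
  apply: Or31 => e /=; apply: (@vvars_vnode (VNode l r) (VNode a b)).
  exact: lrT.
case=> [[-> ->]|lrT].
  case: tT => /vvars_vnode sub; [apply: Or33|apply: Or32] => e er; apply/negP => /sub.
    by move/dis; apply.
  exact: dis er.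
case: tT lrT => tT [] lrT.
- exact: IHa.
- by apply: Or32 => e el; apply/negP => /(vvars_vnode tT)/dis; apply;
    apply: (vvars_vnode lrT); rewrite /= mem_cat el.
- apply: Or32 => e el; apply/negP => /(vvars_vnode tT); apply: dis.
  by apply: (vvars_vnode lrT); rewrite /= mem_cat el.
- exact: IHb.
Qed.

Lemma decomposes_along_vnode (D : strdnnf X) (t : vtree X) :
  vnode_of t (vtree_of D) -> decomposes_along D [set e in vvars t].
Proof.
move=> tT s s0 s1 gs.
have [l [r [lamE sides]]] := lam_and gs.
have lrT : vnode_of (VNode l r) (vtree_of D) by rewrite -lamE; exact: lam_node.
have vars_in u v : vnode_of (lam u) v -> {subset vars_below (gate_of D) u <= vvars v}.
  by move=> /vvars_vnode sub e /(lam_vars)/sub.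
have dis (A : {set X}) (v : vtree X) : {subset A <= vvars v} ->
    {in vvars v, forall e, e \notin vvars t} -> [disjoint A & [set e in vvars t]].
  move=> Av vt; rewrite disjoint_subset; apply/subsetP => e /Av/vt.
  by rewrite !inE.
case: (vvars_laminar (@vtree_uniq _ D) tT lrT) => [sub|dl|dr].
- apply: Or31; apply/subsetP => e /(lam_vars); rewrite lamE inE.
  exact: sub.
- case: sides => -[v0 v1]; [apply: Or32|apply: Or33]; apply: dis dl; exact: vars_in.
- case: sides => -[v0 v1]; [apply: Or33|apply: Or32]; apply: dis dr; exact: vars_in.
Qed.

Lemma same_vtree_vvars (u u' : vtree X) : same_vtree u u' -> vvars u =i vvars u'.
Proof.
elim: u u' => [x|a IHa b IHb] [y|a' b'] //=; first by move/eqP->.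
by case/orP=> /andP[/IHa ea /IHb eb] e; rewrite !mem_cat ea eb // orbC.
Qed.

(** Exchanging children preserves the cuts, so a node chosen for one operand of a conjunction also
    serves the other. *)
Lemma same_vtree_vnode (T T' t : vtree X) : same_vtree T T' -> vnode_of t T ->
  exists2 t', vnode_of t' T' & vvars t =i vvars t'.
Proof.
elim: T T' => [x|a IHa b IHb] T'; first by move=> st /= [->|//]; exists T'; [exact: vnode_refl|exact: same_vtree_vvars].
move=> st /= [->|tab]; first by exists T'; [exact: vnode_refl|exact: same_vtree_vvars].
case: T' st => //= a' b' /orP[]/andP[sa sb]; case: tab.
- by move=> /(IHa _ sa)[t' t'T e]; exists t' => //; right; left.
- by move=> /(IHb _ sb)[t' t'T e]; exists t' => //; right; right.
- by move=> /(IHa _ sa)[t' t'T e]; exists t' => //; right; right.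
- by move=> /(IHb _ sb)[t' t'T e]; exists t' => //; right; left.
Qed.

(* Variables absent from the vtree are grafted above its root: the cuts this
   adds are trivial for the circuit. *)
Definition graft (T : vtree X) : vtree X :=
  foldr (fun e t => VNode (VLeaf e) t) T (enum X).

Lemma graft_full T e : e \in vvars (graft T).
Proof.
have : e \in enum X by rewrite mem_enum.
rewrite /graft; elim: (enum X) => //= f s IH; rewrite !inE.
by case: (e == f) => //= /IH.
Qed.

(** [graft] adds a leaf for every variable, so leaves may repeat; only the kind of cut at each node
    matters. *)
Lemma graft_vnode T t : vnode_of t (graft T) ->
  [\/ vnode_of t T, exists e, t = VLeaf e | {subset vvars T <= vvars t}].
Proof.
rewrite /graft; elim: (enum X) => /= [|f s IH]; first exact: Or31.
case=> [->|[[->|//]|/IH//]].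
  apply: Or33 => e eT /=; rewrite inE; apply/orP; right.
  by elim: s {IH} => //= g s IH; rewrite inE IH orbT.
by apply: Or32; exists f.
Qed.

Lemma decomposes_along_graft (D1 D : strdnnf X) (t : vtree X) :
  same_vtree (vtree_of D1) (vtree_of D) ->
  vnode_of t (graft (vtree_of D1)) -> decomposes_along D [set e in vvars t].
Proof.
move=> same /graft_vnode[tT|[e ->]|sub].
- have [t' t'T eq_t] := same_vtree_vnode same tT.
  have -> : [set e in vvars t] = [set e in vvars t'] by apply/setP => e; rewrite !inE eq_t.
  exact: decomposes_along_vnode.
- have -> : [set e0 in vvars (VLeaf e)] = [set e] by apply/setP => e0; rewrite !inE.
  exact: decomposes_along1.
- move=> s s0 s1 _; apply: Or31; apply/subsetP => e /(lam_vars) es.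
  rewrite inE; apply: sub; rewrite (same_vtree_vvars same).
  exact: vvars_vnode (lam_node s) _ es.
Qed.

End Structured.

(** * Fooling sets for Tseitin formulas *)

(** Two branches are merged by adding the set sizes on one side and keeping the larger set on the
    other: the product doubles. *)
Lemma double_leq_mul p a a' b b' :
  p <= a * b -> p <= a' * b' -> b' <= b -> 2 * p <= (a + a') * b.
Proof.
move=> ab a'b' b'b; rewrite mul2n -addnn mulnDl leq_add //.
by apply: leq_trans a'b' _; rewrite leq_mul.
Qed.

Section CNF.
Variable X : finType.
Implicit Types (x y a : assignment X) (A : {set X}) (H : cnf X).

Lemma cnf_satP x H : reflect (forall C, C \in H -> clause_sat x C) (cnf_sat x H).
Proof. exact: (iffP forall_inP). Qed.

Lemma excluding_clauseP x a A :
  reflect {in A, x =1 a} (~~ clause_sat x (excluding_clause A a)).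
Proof.
apply: (iffP idP) => [nsat e eA|xa].
  apply/eqP; apply: contraNT nsat => xae; apply/exists_inP; exists (e, ~~ a e).
    by apply/imsetP; exists e.
  by move: xae => /=; case: (x e); case: (a e).
apply/negP => /exists_inP[_ /imsetP[e eA ->]] /=.
by rewrite xa //; case: (a e).
Qed.

Lemma eq_excluding_clause x a A : {in A, x =1 a} ->
  excluding_clause A x = excluding_clause A a.
Proof. by move=> xa; apply: eq_in_imset => e eA; rewrite xa. Qed.

Definition fooling (Y : {set X}) H (M : {set assignment X}) : Prop :=
  forall x y, x \in M -> y \in M -> x != y ->
    ~ (cnf_sat (mix Y x y) H /\ cnf_sat (mix Y y x) H).

End CNF.

Section Tseitin.
Variables (G : mgraph) (c : charge G).
Hypothesis connG : connected_graph G.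
Implicit Types (x y z : assignment (edge G)) (u v w : vert G) (e f : edge G).
Implicit Types (H : cnf (edge G)) (S : {set vert G}).

Lemma connected_within v w : connect (within setT) v w.
Proof.
apply: connect_sub (connG v w) => a b ab; apply: connect1.
by rewrite /within /= ab !finset.in_setT.
Qed.

Lemma tseitin_falsified H x C : H \subset tseitin c -> C \in H -> ~~ clause_sat x C ->
  exists2 v, boundary x v != c v & C = excluding_clause (inc v) x.
Proof.
move=> /subsetP HF /HF /bigcupP[v _ /imsetP[a]].
rewrite inE parity_satE => av -> /excluding_clauseP xa; exists v.
  by rewrite (eq_boundary xa).
by apply: esym; apply: eq_excluding_clause.
Qed.

(** The only Tseitin clause falsified by [x] is the clause of [v1] that excludes [x], and it is
    missing from [H]. *)
Definition near_model H v1 x : Prop :=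
  (forall v, boundary x v = c v (+) (v == v1)) /\ excluding_clause (inc v1) x \notin H.

Lemma near_model_sat H v1 x : H \subset tseitin c -> near_model H v1 x -> cnf_sat x H.
Proof.
move=> HF [bx nC]; apply/cnf_satP => C CH; apply: contraT => nsat.
have [v bv CE] := tseitin_falsified HF CH nsat.
move: bv; rewrite bx; have [vE _|_] := eqVneq v v1; last by rewrite addbF eqxx.
by rewrite -vE -CE CH in nC.
Qed.

Lemma near_model_flip H v1 x z : (forall v, boundary z v = false) ->
  {in inc v1, forall e, z e = false} -> near_model H v1 x -> near_model H v1 (flip x z).
Proof.
move=> bz z0 [bx nC]; split=> [v|]; first by rewrite boundary_flip bz addbF.
rewrite (@eq_excluding_clause _ _ x) // => e ev.
by rewrite flipE z0 // addbF.
Qed.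

(** With an even charge, a chain with boundary [c] would satisfy the formula. *)
Lemma odd_charge : unsatisfiable (tseitin c) -> \big[addb/false]_v c v = true.
Proof.
move=> unsat; apply/negbNE/negP => /negbTE even.
have [z _ bz] := @T_join G setT c (fun u v _ _ => connected_within u v)
  (fun v _ => finset.in_setT v) even.
have := unsat z; rewrite (_ : cnf_sat z (tseitin c)) //; apply/cnf_satP => C CF.
apply: contraT => nsat; have [v] := tseitin_falsified (subxx _) CF nsat.
by rewrite bz eqxx.
Qed.

(* A model falsifying several parity constraints can be repaired along a path
   between two of them that avoids the others. *)
Lemma exists_near_model H x : unsatisfiable (tseitin c) -> H \subset tseitin c ->
  cnf_sat x H -> exists v1 y, near_model H v1 y.
Proof.
move=> unsat HF.
have [n] := ubnP #|[set v | boundary x v != c v]|; elim: n x => // n IH x.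
set V := [set v | _] => ltV xH.
have VP v : (v \in V) = (boundary x v (+) c v).
  by rewrite inE; case: (boundary x v); case: (c v).
have oddV : \big[addb/false]_v (v \in V) = true.
  by under eq_bigr do rewrite VP; rewrite big_split /= handshake odd_charge.
have [u uV] : exists u, u \in V.
  apply: contrapT => noV; move: oddV; rewrite big1 // => v _.
  by apply/negbTE/negP => vV; apply: noV; exists v.
have [only|[v [vV vu]]] : (forall v, v \in V -> v = u) \/ exists v, v \in V /\ v != u.
  have [?|no] := pselect (exists v, v \in V /\ v != u); [by right|left=> v vV].
  by apply/eqP/contraT => vu; case: no; exists v.
  exists u, x; split=> [v|].
    have := VP v; have -> : (v \in V) = (v == u).
      by apply/idP/eqP => [/only|->].
    by move->; rewrite addbC -addbA addbb addbF.
  apply/negP => CH; have := cnf_satP _ _ xH _ CH.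
  exact/negP/excluding_clauseP.
(* [X] is what [u] reaches without entering [V] again. A first exit [b] from [X] is in [V], so a
   path from [u] to [b] meets no other violated vertex. *)
pose r := [rel a b | @adj G a b && (b \notin V)].
pose X := [set d | connect r u d].
have uX : u \in X by rewrite inE connect0.
have XV (y : vert G) : y \in X -> y != u -> y \notin V.
  rewrite inE => /connectP[p]; case/lastP: p => [_ ->|p b]; first by rewrite eqxx.
  by rewrite rcons_path last_rcons => /andP[_ /andP[_ ?]] ->.
have [a [b [aX bX ab]]] : exists a b, [/\ a \in X, b \notin X & @adj G a b].
  apply: contrapT => no.
  have : v \in X.
    apply: (connect_stable (r := @adj G) _ uX (connG u v)) => a aX b ab.
    by apply/negbNE/negP => bX; apply: no; exists a, b.
  by move=> /XV/(_ vu); rewrite vV.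
have bV : b \in V.
  apply: contraNT bX => bV; move: aX; rewrite !inE => ua.
  by apply: connect_trans ua (connect1 _); rewrite /r /= ab.
have bu : b != u by apply: contraNneq bX => ->.
have conn : connect (within (b |: X)) u b.
  have aX' : a \in b |: X by rewrite in_setU1 aX orbT.
  apply: (@connect_trans _ _ a); last first.
    by apply: connect1; rewrite /within /= ab aX' setU11.
  have : connect (within X) u a.
    move: aX; rewrite inE => /connectP[p pth ->].
    elim: p (u) uX pth => [|d p IHp] y yX /=; first by rewrite connect0.
    case/andP=> yd pth; have dX : d \in X.
      by move: yX; rewrite !inE => uy; apply: (connect_trans uy); exact: connect1.
    apply: connect_trans (IHp _ dX pth); apply: connect1.
    by case/andP: yd => yd _; rewrite /within /= yd yX dX.
  by apply: connect_withinS; apply: subsetUr.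
have [z zX bz] := path_join conn.
have z0 v' e : v' \in V -> v' != u -> v' != b -> v' \in ends e -> z e = false.
  move=> v'V v'u v'b v'e; apply: contraTF v'V => /zX/subsetP/(_ _ v'e).
  by rewrite in_setU1 (negbTE v'b) /= => /XV; apply.
have V'E : [set v | boundary (flip x z) v != c v] = V :\ u :\ b.
  apply/setP => v'; rewrite !(in_setD1, inE) boundary_flip bz.
  have [->|v'b] /= := eqVneq v' b.
    move: bV; rewrite inE (negbTE bu).
    by case: (boundary x b); case: (c b).
  have [->|v'u] /= := eqVneq v' u.
    by move: uV; rewrite inE; case: (boundary x u); case: (c u).
  by rewrite addbF.
apply: (IH (flip x z)).
  rewrite V'E; apply: leq_trans (_ : #|V| <= n) => //.
  apply/proper_card/properP; split; last by exists u; rewrite // !in_setD1 eqxx andbF.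
  by apply: subset_trans (subsetDl _ _) (subsetDl _ _).
apply/cnf_satP => C CH; apply: contraT => nsat.
have [v' bv' CE] := tseitin_falsified HF CH nsat.
have : v' \in V :\ u :\ b by rewrite -V'E inE.
rewrite !in_setD1 => /and3P[v'b v'u v'V].
have := cnf_satP _ _ xH _ CH; rewrite CE; apply: contraTT => _.
by apply/excluding_clauseP => e; rewrite inE => v'e; rewrite flipE (z0 v') // addbF.
Qed.

(** * Branching along cycles guided by the haven *)

Section Branching.
Variables (l : nat) (beta : {set vert G} -> {set vert G}).
Hypothesis hb : haven l beta.

Lemma haven_set0 v : v \in beta set0.
Proof.
have le0 : #|(set0 : {set vert G})| <= l by rewrite cards0.
have [u ub] := haven_nonempty hb le0.
apply: (connect_stable (r := @adj G) _ ub (connG u v)) => a ab b adj_ab.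
by apply: (haven_closed hb ab adj_ab); rewrite in_set0.
Qed.

(** The ends of [e] and [f] other than [w] are joined inside [beta (w |: S)], which closes a cycle
    that avoids [S] and uses only [e] and [f] at [w]. *)
Lemma switch_chain S w e f : #|S| < l -> w \notin S -> e != f ->
  into beta S w e -> into beta S w f ->
  exists z : assignment (edge G), [/\ forall v, boundary z v = false,
    {in S, forall s, {in inc s, forall g, z g = false}}
  & {in inc w, forall g, z g = (g == e) || (g == f)}].
Proof.
move=> ltS wS ef /(intoP _ _ _ _)[a ab eE] /(intoP _ _ _ _)[b bb fE].
have lewS : #|w |: S| <= l := leq_trans (cardsU1_le S w) ltS.
pose z0 := flip (edge_chain e) (edge_chain f).
have bz0 v : boundary z0 v = (v == a) (+) (v == b).
  rewrite boundary_flip !boundary_edge eE fE !in_set2.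
  have wb : w \notin beta (w |: S).
    by apply/negP => /(haven_notin hb); rewrite setU11.
  have [->|_] := eqVneq v w; last by [].
  have -> : (w == a) = false by apply: contraNF wb => /eqP{1}->.
  by have -> : (w == b) = false by apply: contraNF wb => /eqP{1}->.
have [z1 z1X bz1] := path_join (haven_connected hb lewS ab bb).
have z1F v g : v \in w |: S -> v \in ends g -> z1 g = false.
  move=> vS vg; apply: contraTF vS => /z1X/subsetP/(_ _ vg).
  exact: (haven_notin hb).
exists (flip z0 z1); split=> [v|s sS g|g].
- by rewrite boundary_flip bz0 bz1 addbb.
- rewrite inE => sg; rewrite !flipE !ffunE (z1F s) ?in_setU1 ?sS ?orbT // addbF.
  have notend h d : ends h = [set w; d] -> d \in beta (w |: S) -> (g == h) = false.
    move=> hE db; apply: contraTF sg => /eqP->; rewrite hE in_set2.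
    apply/norP; split; first by apply: contraNneq wS => <-.
    apply: contraTneq db => <-; apply/negP => /(haven_notin hb).
    by rewrite in_setU1 sS orbT.
  by rewrite (notend _ _ eE ab) (notend _ _ fE bb).
- rewrite inE => wg; rewrite !flipE !ffunE (z1F w) ?setU11 // addbF.
  by have [->|_] := eqVneq g e; [rewrite (negbTE ef)|].
Qed.

Variables (v1 v2 : vert G) (H1 H2 : cnf (edge G)).
Hypotheses (H1F : H1 \subset tseitin c) (H2F : H2 \subset tseitin c).
Hypothesis unsat12 : forall x, ~ (cnf_sat x H1 /\ cnf_sat x H2).

(** Within [S], the two models may differ only on edges at [v1] and [v2]; a hang without terminals
    is adjacent to neither. *)
Definition terminals := [set u | @adj G v1 u || @adj G v2 u].

(** [J] is the difference of [x1] and [x2] on the edges meeting the hang of [w]. It vanishes at [S],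
    where the models agree or no edge reaches the hang, and has no boundary in the hang, where both
    satisfy the parities. Its boundary thus lies in [beta (w |: S)], and a chain there cancels it
    without touching [w] or [S]. *)
Lemma synchronise S w x1 x2 : v1 \in S -> v2 \in S -> #|S| < l ->
  w \in core beta S -> [disjoint hang beta S w & terminals] ->
  near_model H1 v1 x1 -> near_model H2 v2 x2 ->
  {in S, forall s, s != v1 -> s != v2 -> {in inc s, x1 =1 x2}} ->
  exists x2', [/\ near_model H2 v2 x2', {in S, forall s, {in inc s, x2' =1 x2}}
    & {in inc w, x2' =1 x1}].
Proof.
move=> v1S v2S ltS wc dis near1 near2 agree.
have lewS : #|w |: S| <= l := leq_trans (cardsU1_le S w) ltS.
have wb := core_beta wc.
have wS : w \notin S := haven_notin hb wb.
set Hg := hang beta S w in dis.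
have wH : w \in Hg.
  by rewrite in_setD wb andbT; apply/negP => /(haven_notin hb); rewrite setU11.
pose meets e := ~~ [disjoint ends e & Hg].
pose J : assignment (edge G) := [ffun e => (x1 e (+) x2 e) && meets e].
have meetsP v e : v \in ends e -> meets e -> v \notin Hg -> exists2 u, u \in Hg & @adj G v u.
  move=> ve /pred0Pn[u /andP[/= ue uH]] vH; exists u => //.
  apply/existsP; exists e; have [d eE vd] := adj_other ve.
  move: ue; rewrite eE in_set2 => /orP[]/eqP uE; last by rewrite uE.
  by rewrite -uE uH in vH.
have J_S s e : s \in S -> s \in ends e -> J e = false.
  move=> sS se; rewrite ffunE; apply/negP => /andP[x12 me].
  have sH : s \notin Hg.
    by rewrite in_setD negb_and; apply/orP; right; apply/negP => /(haven_notin hb); rewrite sS.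
  have [u uH su] := meetsP _ _ se me sH.
  have /negbT := disjointFr dis uH; rewrite inE negb_or => /andP[n1 n2].
  have s1 : s != v1 by apply: contraNneq n1 => <-.
  have s2 : s != v2 by apply: contraNneq n2 => <-.
  by move: x12; rewrite (agree s sS s1 s2) ?addbb // inE.
have J_bd v : boundary J v -> v \in beta (w |: S).
  apply: contraTT => vX; apply/negbT.
  have [vH|vH] := boolP (v \in Hg).
    have vnS : v \notin S by move: vH; rewrite in_setD => /andP[_ /(haven_notin hb)].
    have -> : boundary J v = boundary (flip x1 x2) v.
      apply: eq_bigr => e ve; rewrite !ffunE.
      have -> : meets e by apply/pred0Pn; exists v; rewrite /= ve.
      by rewrite andbT.
    rewrite boundary_flip near1.1 near2.1.
    have [v1E v2E] : (v == v1) = false /\ (v == v2) = false.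
      by split; apply: contraNF vnS => /eqP->.
    by rewrite v1E v2E !addbF addbb.
  apply: boundary0 => e ve; have [vS|vS] := boolP (v \in S); first exact: J_S vS ve.
  rewrite ffunE; apply/negP => /andP[_ me].
  have [u uH vu] := meetsP _ _ ve me vH.
  case/negP: vH; rewrite in_setD vX /=.
  move: uH; rewrite in_setD => /andP[_ ub]; apply: (haven_closed hb ub) => //.
  by rewrite adj_sym.
have conX : {in beta (w |: S) &, forall u v, connect (within (beta (w |: S))) u v}.
  by move=> u v; exact: haven_connected hb _ _ _ lewS.
have [z zX bz] := T_join conX J_bd (handshake J).
have z0 v e : v \in w |: S -> v \in ends e -> z e = false.
  move=> vS ve; apply: contraTF vS => /zX/subsetP/(_ _ ve).
  exact: (haven_notin hb).
have JzS s : s \in S -> {in inc s, forall e, flip J z e = false}.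
  move=> sS e; rewrite inE => se.
  by rewrite flipE (J_S s) // (z0 s) // in_setU1 sS orbT.
exists (flip x2 (flip J z)); split.
- apply: near_model_flip near2; last exact: JzS.
  by move=> v; rewrite boundary_flip bz addbb.
- by move=> s sS e se; rewrite flipE (JzS s) // addbF.
- move=> e; rewrite inE => we; rewrite !flipE (z0 w) ?setU11 // addbF ffunE.
  have -> : meets e by apply/pred0Pn; exists w; rewrite /= we.
  by rewrite andbT addbC -addbA addbb addbF.
Qed.

(** Adding [e] and a path from its far end to [v1] avoiding [w] moves the violation from [v1] to
    [w]. The result falsifies some clause of [H1] or [H2], which can only be the one of [w]; around
    [w] it equals [x1] with [e] flipped. *)
Lemma conflict_clause S w e x1 : v1 != w -> #|S| < l -> v1 \in beta [set w] ->
  near_model H1 v1 x1 -> into beta S w e ->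
  excluding_clause (inc w) (flip x1 (edge_chain e)) \in H1 :|: H2.
Proof.
move=> v1w ltS v1b near1 /(intoP _ _ _ _)[y yb eE].
have lewS : #|w |: S| <= l := leq_trans (cardsU1_le S w) ltS.
have lew : #|[set w]| <= l by rewrite cards1; apply: leq_trans ltS.
have yb' : y \in beta [set w].
  by apply: (subsetP (haven_sub hb _ lewS)) yb; apply: subsetUl.
have wb : w \notin beta [set w].
  by apply/negP => /(haven_notin hb); rewrite set11.
have [z zX bz] := path_join (haven_connected hb lew yb' v1b).
pose x := flip (flip x1 (edge_chain e)) z.
have xw : {in inc w, x =1 flip x1 (edge_chain e)}.
  move=> g; rewrite inE => wg; rewrite /x flipE.
  case zg: (z g); last by rewrite addbF.
  by case/negP: wb; exact: subsetP (zX _ zg) _ wg.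
have bx v : boundary x v = c v (+) (v == w).
  rewrite !boundary_flip near1.1 boundary_edge eE bz in_set2.
  have [->|vw] := eqVneq v w.
    have -> : (w == v1) = false by rewrite eq_sym (negbTE v1w).
    have -> : (w == y) = false by apply: contraNF wb => /eqP{1}->.
    by rewrite !addbF.
  by case: (c v); case: (v == v1); case: (v == y).
rewrite -(eq_excluding_clause xw) in_setU.
have falsified H C : H \subset tseitin c -> C \in H -> ~~ clause_sat x C ->
    excluding_clause (inc w) x \in H.
  move=> HF CH nsat; have [v bv CE] := tseitin_falsified HF CH nsat.
  suff <- : v = w by rewrite -CE.
  by apply/eqP; apply: contraNT bv => /negbTE vw; rewrite bx vw addbF.
have [sat1|/forall_inPn[C CH nsat]] := boolP (cnf_sat x H1); last first.
  by rewrite (falsified _ _ H1F CH nsat).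
have [sat2|/forall_inPn[C CH nsat]] := boolP (cnf_sat x H2); last first.
  by rewrite (falsified _ _ H2F CH nsat) orbT.
by case: (@unsat12 x).
Qed.

Variables (Y : {set edge G}) (l0 : nat).
Hypothesis unsaturated : forall S, #|S| <= l0 -> ~ saturated beta Y S.
Hypothesis ltl0 : l0 < l.

Lemma find_switch S : #|S| + #|terminals| < l0 -> exists w e f,
  [/\ w \in core beta S /\ v1 \in beta [set w],
      [disjoint hang beta S w & terminals],
      into beta S w e, into beta S w f & e \in Y /\ f \notin Y].
Proof.
move=> ltS.
(* The unsuitable core vertices are deleted in advance. Hangs are disjoint, so at most
   [#|terminals|] of them contain a terminal and at most one hides [v1]; the strict inequality pays
   for the latter. *)
pose B1 := [set w in core beta S | ~~ [disjoint hang beta S w & terminals]].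
pose B2 := [set w in core beta set0 | ~~ [disjoint hang beta set0 w & [set v1]]].
have leB1 : #|B1| <= #|terminals| by apply: (hang_meet_card hb); lia.
have leB2 : #|B2| <= 1.
  by rewrite -(cards1 v1); apply: (hang_meet_card hb); rewrite cards0.
pose S' := S :|: (B1 :|: B2).
have leS' : #|S'| <= l0 by rewrite /S' !cardsU; lia.
have SS' : S \subset S' by apply: subsetUl.
have ltS'l : #|S'| < l by lia.
have [w [e [f [wc ei fi eY fY]]]] : exists w e f, [/\ w \in core beta S',
    into beta S' w e, into beta S' w f, e \in Y & f \notin Y].
  apply: contrapT => none; apply: (unsaturated leS') => w e f wc ei fi eY.
  by apply/negbNE/negP => fY; apply: none; exists w, e, f.
have := haven_notin hb (core_beta wc).
have wcS : w \in core beta S := subsetP (core_sub hb SS' ltS'l) _ wc.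
have wc0 : w \in core beta set0 := subsetP (core_sub hb (sub0set _) ltS'l) _ wc.
rewrite !in_setU !negb_or [w \in B1]inE [w \in B2]inE wcS wc0 /= !negbK.
case/and3P=> _ dis dis0; exists w, e, f; split=> //.
- split=> //; apply: contraTT dis0 => v1w; rewrite disjoint_sym disjoints1.
  by rewrite in_setD haven_set0 finset.setU0 v1w.
- exact: into_sub hb _ _ _ _ SS' ltS'l ei.
- exact: into_sub hb _ _ _ _ SS' ltS'l fi.
Qed.

(** Mixing a member of [N] on [Y] with a member of [M] off [Y] flips [e] but not [f] at [w], so the
    clause in [H] is falsified. *)
Lemma fooling_union H w x0 e f (M N : {set assignment (edge G)}) :
  e \in Y -> f \notin Y -> e \in inc w ->
  excluding_clause (inc w) (flip x0 (edge_chain e)) \in H ->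
  {in M, forall x, {in inc w, x =1 x0}} ->
  {in N, forall x, {in inc w, forall g, x g = x0 g (+) ((g == e) || (g == f))}} ->
  fooling Y H M -> fooling Y H N ->
  fooling Y H (M :|: N) /\ #|M :|: N| = #|M| + #|N|.
Proof.
move=> eY fY ew CH Mw Nw foolM foolN.
have cross x y : x \in M -> y \in N -> ~~ cnf_sat (mix Y y x) H.
  move=> xM yN; apply/negP => /cnf_satP/(_ _ CH); apply/negP/excluding_clauseP.
  move=> g gw; rewrite !ffunE; case: ifPn => gY.
    rewrite (Nw _ yN) //; have -> : (g == f) = false by apply: contraNF fY => /eqP<-.
    by rewrite orbF.
  rewrite (Mw _ xM) //; have -> : (g == e) = false by apply: contraNF gY => /eqP->.
  by rewrite addbF.
have dis x : x \in M -> x \in N -> False.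
  move=> /Mw/(_ _ ew) xe /Nw/(_ _ ew); rewrite xe eqxx /=.
  by case: (x0 e).
split.
  move=> x y; rewrite !in_setU => /orP[xM|xN] /orP[yM|yN] xy [sxy syx].
  - by case: (foolM x y).
  - by move: (cross _ _ xM yN); rewrite syx.
  - by move: (cross _ _ yM xN); rewrite sxy.
  - by case: (foolN x y).
rewrite cardsU (_ : M :&: N = set0) ?cards0 ?subn0 //.
by apply/setP => x; rewrite in_setI in_set0; apply/negP => /andP[/dis].
Qed.

Definition near_family H v x0 S (M : {set assignment (edge G)}) : Prop :=
  {in M, forall x, near_model H v x /\ {in S, forall s, {in inc s, x =1 x0}}}.

(* Every branching clause lies in H1 or in H2: the branching extends the fooling
   set of the one that contains it, whence the bound on the product. *)
Lemma fooling_pair m S x1 x2 : v1 \in S -> v2 \in S ->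
  #|S| + m + #|terminals| <= l0 ->
  near_model H1 v1 x1 -> near_model H2 v2 x2 ->
  {in S, forall s, s != v1 -> s != v2 -> {in inc s, x1 =1 x2}} ->
  exists M1 M2 : {set assignment (edge G)},
    [/\ 2 ^ m <= #|M1| * #|M2|,
        near_family H1 v1 x1 S M1 /\ near_family H2 v2 x2 S M2,
        fooling Y H1 M1 & fooling Y H2 M2].
Proof.
elim: m S x1 x2 => [|m IH] S x1 x2 v1S v2S leS near1 near2 agree.
  exists [set x1], [set x2]; split; first by rewrite !cards1.
  - by split=> x /set1P->.
  - by move=> x y /set1P-> /set1P->; rewrite eqxx.
  - by move=> x y /set1P-> /set1P->; rewrite eqxx.
have ltS : #|S| < l by lia.
have [|w [e [f [[wc v1b] dis ei fi [eY fY]]]]] := @find_switch S; first by lia.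
have wS : w \notin S := haven_notin hb (core_beta wc).
have [x3 [near3 x3S x3w]] := synchronise v1S v2S ltS wc dis near1 near2 agree.
have ef : e != f by apply: contraNneq fY => <-.
have [z [bz zS zw]] := switch_chain ltS wS ef ei fi.
have near1z := near_model_flip bz (zS _ v1S) near1.
have near3z := near_model_flip bz (zS _ v2S) near3.
have SwS : S \subset w |: S by apply: subsetUr.
have leS' : #|w |: S| + m + #|terminals| <= l0.
  by apply: leq_trans leS; rewrite addnS -addSn !leq_add2r cardsU1_le.
have agree3 : {in w |: S, forall s, s != v1 -> s != v2 -> {in inc s, x1 =1 x3}}.
  move=> s /setU1P[->|sS] s1 s2 g gs; first by rewrite x3w.
  by rewrite (x3S s) // (agree s).
have agree3z : {in w |: S, forall s, s != v1 -> s != v2 -> {in inc s, flip x1 z =1 flip x3 z}}.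
  by move=> s sS s1 s2 g gs; rewrite !flipE (agree3 s).
have v1S' := subsetP SwS _ v1S; have v2S' := subsetP SwS _ v2S.
(* Both branches continue with [w] added to [S], which freezes the edges at [w]: as in [x1] for one
   branch, with [e] and [f] flipped for the other. *)
have [M1 [M2 [cM [fM1 fM2] foolM1 foolM2]]] :=
  IH (w |: S) x1 x3 v1S' v2S' leS' near1 near3 agree3.
have [N1 [N2 [cN [fN1 fN2] foolN1 foolN2]]] :=
  IH (w |: S) _ _ v1S' v2S' leS' near1z near3z agree3z.
have ew : e \in inc w.
  by case/(intoP _ _ _ _): ei => y _ eE; rewrite inE eE set21.
have M1w : {in M1, forall x, {in inc w, x =1 x1}}.
  by move=> x /fM1[_ xS] g gw; rewrite (xS w) ?setU11.
have M2w : {in M2, forall x, {in inc w, x =1 x1}}.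
  by move=> x /fM2[_ xS] g gw; rewrite (xS w) ?setU11 // x3w.
have N1w : {in N1, forall x, {in inc w, forall g, x g = x1 g (+) ((g == e) || (g == f))}}.
  by move=> x /fN1[_ xS] g gw; rewrite (xS w) ?setU11 // flipE zw.
have N2w : {in N2, forall x, {in inc w, forall g, x g = x1 g (+) ((g == e) || (g == f))}}.
  by move=> x /fN2[_ xS] g gw; rewrite (xS w) ?setU11 // flipE zw // x3w.
have fM1' : near_family H1 v1 x1 S M1.
  by move=> x /fM1[nx xS]; split=> // s sS; apply: xS; apply: (subsetP SwS).
have fM2' : near_family H2 v2 x2 S M2.
  move=> x /fM2[nx xS]; split=> // s sS g gs.
  by rewrite (xS s) ?(subsetP SwS) // (x3S s).
have fN1' : near_family H1 v1 x1 S N1.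
  move=> x /fN1[nx xS]; split=> // s sS g gs.
  by rewrite (xS s) ?(subsetP SwS) // flipE (zS s) // addbF.
have fN2' : near_family H2 v2 x2 S N2.
  move=> x /fN2[nx xS]; split=> // s sS g gs.
  by rewrite (xS s) ?(subsetP SwS) // flipE (zS s) // addbF (x3S s).
have v1w : v1 != w by apply: contraNneq wS => <-.
have := conflict_clause v1w ltS v1b near1 ei; rewrite in_setU expnS => /orP[CH|CH].
  have [foolU cU] := fooling_union eY fY ew CH M1w N1w foolM1 foolN1.
  have fU : near_family H1 v1 x1 S (M1 :|: N1).
    by move=> x /setUP[/fM1'|/fN1'].
  have [le|le] := leqP #|N2| #|M2|.
    by exists (M1 :|: N1), M2; split=> //; rewrite cU; apply: double_leq_mul le.
  exists (M1 :|: N1), N2; split=> //; rewrite cU [#|M1| + _]addnC.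
  exact: double_leq_mul (ltnW le).
have [foolU cU] := fooling_union eY fY ew CH M2w N2w foolM2 foolN2.
have fU : near_family H2 v2 x2 S (M2 :|: N2).
  by move=> x /setUP[/fM2'|/fN2'].
have [le|le] := leqP #|N1| #|M1|.
  exists M1, (M2 :|: N2); split=> //; rewrite cU [#|M1| * _]mulnC.
  by apply: double_leq_mul le; rewrite mulnC.
exists N1, (M2 :|: N2); split=> //; rewrite cU [#|N1| * _]mulnC [#|M2| + _]addnC.
by apply: double_leq_mul (ltnW le); rewrite mulnC.
Qed.

End Branching.
End Tseitin.

(** * Refutations *)

Lemma same_vtree_refl (X : eqType) (t : vtree X) : same_vtree t t.
Proof. by elim: t => //= a -> b ->. Qed.

Section Compilation.
Variables (X : finType) (apply : strdnnf X -> strdnnf X -> strdnnf X).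
Hypothesis applyP : is_apply apply.
Variables (F : cnf X) (N : nat) (Sg : 'I_N.+1 -> strdnnf X).
Hypothesis compiled : compilation apply F Sg.

Lemma apply_accepts S1 S2 a : same_vtree (vtree_of S1) (vtree_of S2) ->
  accepts (apply S1 S2) a <-> accepts S1 a /\ accepts S2 a.
Proof. by case: applyP => A appA /appA[_ acc _]. Qed.

Lemma compiled_subset i : exists2 H : cnf X, H \subset F &
  forall a, accepts (Sg i) a <-> cnf_sat a H.
Proof.
have [n] := ubnP (i : nat); elim: n i => // n IH i lt_i.
case: (compiled.2 i) => [[C CF CE]|[j [k [ji ki same ->]]]|[j [ji _ jE]]].
- exists [set C]; first by rewrite sub1set.
  move=> a; rewrite CE; split=> [aC|/cnf_satP]; last by apply; rewrite set11.
  by apply/cnf_satP => _ /set1P->.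
- have [Hj HjF HjE] := IH j (leq_trans ji lt_i).
  have [Hk HkF HkE] := IH k (leq_trans ki lt_i).
  exists (Hj :|: Hk); first by rewrite subUset HjF.
  move=> a; rewrite (apply_accepts _ same) HjE HkE; split.
    by move=> [/cnf_satP aj /cnf_satP ak]; apply/cnf_satP => C /setUP[/aj|/ak].
  by move=> /cnf_satP aH; split; apply/cnf_satP => C CH; apply: aH; rewrite in_setU CH ?orbT.
- have [H HF HE] := IH j (leq_trans ji lt_i).
  by exists H => // a; rewrite jE HE.
Qed.

(** Clauses are satisfiable and a change of vtree preserves models, so the descent from the
    unsatisfiable last circuit ends at a conjunction of satisfiable ones. *)
Lemma conflicting_apply : unsatisfiable F ->
  (forall C, C \in F -> exists a, clause_sat a C) ->
  exists j k, [/\ same_vtree (vtree_of (Sg j)) (vtree_of (Sg k)),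
    exists a, accepts (Sg j) a, exists a, accepts (Sg k) a
    & forall a, ~ (accepts (Sg j) a /\ accepts (Sg k) a)].
Proof.
move=> unsat satC.
have unsat_max a : ~ accepts (Sg ord_max) a.
  by rewrite compiled.1; apply/negP; exact: unsat.
suff main n (i : 'I_N.+1) : i < n -> (forall a, ~ accepts (Sg i) a) ->
    exists j k, [/\ same_vtree (vtree_of (Sg j)) (vtree_of (Sg k)),
      exists a, accepts (Sg j) a, exists a, accepts (Sg k) a
      & forall a, ~ (accepts (Sg j) a /\ accepts (Sg k) a)].
  exact: main (ltn_ord ord_max) unsat_max.
elim: n i => // n IH i lt_i unsat_i.
case: (compiled.2 i) => [[C CF CE]|[j [k [ji ki same iE]]]|[j [ji _ jE]]].
- by have [a aC] := satC _ CF; case: (unsat_i a); rewrite CE.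
- have [unsat_j|sat_j] := pselect (forall a, ~ accepts (Sg j) a).
    exact: IH (leq_trans ji lt_i) unsat_j.
  have [unsat_k|sat_k] := pselect (forall a, ~ accepts (Sg k) a).
    exact: IH (leq_trans ki lt_i) unsat_k.
  exists j, k; split=> //.
  + by apply: contrapT => no; apply: sat_j => a aj; apply: no; exists a.
  + by apply: contrapT => no; apply: sat_k => a ak; apply: no; exists a.
  + by move=> a; rewrite -(apply_accepts _ same) -iE; exact: unsat_i.
- by apply: IH (leq_trans ji lt_i) _ => a; rewrite -jE; exact: unsat_i.
Qed.

(** An internal root would already have two edges, so the root is a leaf. *)
Lemma small_dnnf (D : dnnf X) : dnnf_size D < 2 ->
  (exists x b, forall a, accepts D a <-> a x = b) \/
  (exists b : bool, forall a, accepts D a <-> b).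
Proof.
move=> ltD; have leaf : size (inputs (gate_of D (Defs.root D))) < 2.
  apply: leq_ltn_trans ltD; rewrite /dnnf_size (bigD1 (Defs.root D)) //=.
  exact: leq_addr.
case gE: (gate_of D (Defs.root D)) leaf => [x b|b|//|//] _.
  left; exists x, b => a; split=> [acc|ab].
    by inversion acc; congruence.
  by apply: (@TrueLit _ _ _ _ x); rewrite gE ab.
right; exists b => a; split=> [acc|bT]; last by apply: TrueConst; rewrite gE bT.
by inversion acc; congruence.
Qed.

End Compilation.

(** * Trivial circuits and the size bound *)

Section Refutation.
Variables (G : mgraph) (c : charge G).
Hypotheses (connG : connected_graph G) (edges2 : 1 < #|edge G|).
Implicit Types (v w : vert G) (e : edge G).

Lemma inc_nonempty v : exists e, e \in inc v.
Proof.
have [e0 _] : exists e0 : edge G, e0 \in edge G by apply/card_gt0P; apply: ltnW.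
have [u [u' [_ eE]]] : exists u u', u != u' /\ ends e0 = [set u; u'].
  by apply/cards2P; rewrite endsP.
have /connectP[[|w p]] := connG v u.
  by move=> _ vu; exists e0; rewrite inE eE vu set21.
by case/andP=> /existsP[e /eqP evw] _ _; exists e; rewrite inE evw set21.
Qed.

Lemma tseitin_clause C : C \in tseitin c ->
  exists v a, C = excluding_clause (inc v) a /\ boundary a v != c v.
Proof.
case/bigcupP=> v _ /imsetP[a]; rewrite inE parity_satE => av ->.
by exists v, a.
Qed.

Lemma tseitin_clause_sat C : C \in tseitin c -> exists a, clause_sat a C.
Proof.
move=> /tseitin_clause[v [a [-> _]]]; have [e ev] := inc_nonempty v.
exists (flip a (edge_chain e)); apply/negbNE/negP => /excluding_clauseP/(_ _ ev).
by rewrite flipE ffunE eqxx; case: (a e).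
Qed.

(** Flipping any edge at [v] in [a] makes the clause true, so a literal equivalent to the clause
    must read that edge. *)
Lemma small_clause (D : dnnf (edge G)) v a : dnnf_size D < 2 ->
  (forall x, accepts D x <-> clause_sat x (excluding_clause (inc v) a)) ->
  #|inc v| = 1.
Proof.
move=> ltD DE; have [e ev] := inc_nonempty v.
apply/eqP/cards1P; exists e; apply/setP => f; rewrite in_set1.
apply/idP/eqP => [fv|->//].
have unsat_a : ~ accepts D a by rewrite DE; apply/negP/excluding_clauseP.
have sat_flip g : g \in inc v -> accepts D (flip a (edge_chain g)).
  move=> gv; rewrite DE; apply/negbNE/negP => /excluding_clauseP/(_ _ gv).
  by rewrite flipE ffunE eqxx; case: (a g).
have [[x [b bE]]|[b bE]] := small_dnnf ltD; last first.
  by case: unsat_a; rewrite bE -(bE (flip a (edge_chain e))); exact: sat_flip.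
have flipx g : g \in inc v -> x = g.
  move=> /sat_flip; rewrite bE flipE ffunE => xb; apply/eqP; apply: contraT => xg.
  by case: unsat_a; rewrite bE -xb (negbTE xg) addbF.
by rewrite -(flipx _ fv) -(flipx _ ev).
Qed.

(** Otherwise [e] would be a whole component, hence the only edge of the connected graph. *)
Lemma pendant_unique e v w : #|inc v| = 1 -> #|inc w| = 1 ->
  v \in ends e -> w \in ends e -> v = w.
Proof.
move=> v1 w1 ve we; apply/eqP/contraT => vw.
have incE u g : #|inc u| = 1 -> u \in ends e -> u \in ends g -> g = e.
  move=> /eqP/cards1P[h hE] ue ug.
  have := in_set1 g h; rewrite -hE inE ug => /esym/eqP->.
  by have := in_set1 e h; rewrite -hE inE ue => /esym/eqP->.
have eE : ends e = [set v; w].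
  apply/esym/eqP; rewrite eqEcard endsP cards2 vw andbT.
  by rewrite subUset !sub1set ve we.
have all_ends u : u \in ends e.
  apply: (connect_stable (r := @adj G) _ ve (connG v u)) => a ae b /existsP[g /eqP gE].
  have ag : a \in ends g by rewrite gE set21.
  have ge : g = e.
    move: ae; rewrite eE in_set2 => /orP[]/eqP aE; rewrite aE in ag.
      exact: incE v1 ve ag.
    exact: incE w1 we ag.
  by rewrite -ge gE set22.
have : #|edge G| <= 1.
  apply/card_le1P => f _ g; rewrite !inE; apply/esym/eqP.
  suff all_e h : h = e by rewrite (all_e f).
  have [u [u' [_ hE]]] : exists u u', u != u' /\ ends h = [set u; u'].
    by apply/cards2P; rewrite endsP.
  have uh : u \in ends h by rewrite hE set21.
  move: (all_ends u); rewrite eE in_set2 => /orP[]/eqP uE; rewrite uE in uh.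
    exact: incE v1 ve uh.
  exact: incE w1 we uh.
by rewrite leqNgt edges2.
Qed.

Variables (apply : strdnnf (edge G) -> strdnnf (edge G) -> strdnnf (edge G)).
Hypothesis applyP : is_apply apply.
Variables (N : nat) (Sg : 'I_N.+1 -> strdnnf (edge G)).
Hypothesis refuted : refutation apply (tseitin c) Sg.

(* If all circuits were trivial, only unit clauses could be compiled, and the
   unit clauses of a connected graph with two edges are jointly satisfiable. *)
Lemma nontrivial_circuit : exists i, 2 <= dnnf_size (Sg i).
Proof.
apply: contrapT => none.
have small i : dnnf_size (Sg i) < 2.
  by rewrite ltnNge; apply/negP => le; apply: none; exists i.
(* Each pendant edge gets the charge of its end of degree one, which is unique by [pendant_unique];
   other edges get [false]. *)
pose a : assignment (edge G) :=
  [ffun e => if [pick v in ends e | #|inc v| == 1] is Some v then c v else false].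
have [unsat [final steps]] := refuted.
suff acc n (i : 'I_N.+1) : i < n -> accepts (Sg i) a.
  have /final := acc _ ord_max (ltn_ord ord_max).
  by rewrite (negbTE (unsat a)).
elim: n i => // n IH i lt_i.
case: (steps i) => [[C CF CE]|[j [k [ji ki same ->]]]|[j [ji _ jE]]].
- rewrite CE; have [v [b [CEv bv]]] := tseitin_clause CF.
  rewrite CEv in CE *; have v1 := small_clause (small i) CE.
  apply/negbNE/negP => /excluding_clauseP ab; case/negP: bv.
  have [e ev] := inc_nonempty v; have ve : v \in ends e by move: ev; rewrite inE.
  rewrite -(eq_boundary ab) /boundary (bigD1 e) //= big1 ?addbF => [|f /andP[vf fe]].
    rewrite ffunE; case: pickP => [w /andP[we /eqP w1]|/(_ v)].
      by rewrite (pendant_unique w1 v1 we ve).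
    by rewrite v1 ve.
  have /cards1P[h hE] : #|inc v| == 1 by rewrite v1.
  case/negP: fe; have := in_set1 f h; rewrite -hE inE vf => /esym/eqP->.
  by have := in_set1 e h; rewrite -hE ev => /esym/eqP->.
- by rewrite (apply_accepts applyP) //; split; apply: IH; [exact: leq_trans ji lt_i|exact: leq_trans ki lt_i].
- by rewrite jE; apply: IH; exact: leq_trans ji lt_i.
Qed.

Lemma adj_card v : #|[set u | @adj G v u]| <= #|inc v|.
Proof.
pose g e := odflt v [pick u in ends e :\ v].
apply: leq_trans (leq_imset_card g (inc v)).
apply/subset_leq_card/subsetP => u; rewrite inE => /existsP[e /eqP eE].
apply/imsetP; exists e; first by rewrite inE eE set21.
have ve : v \in ends e by rewrite eE set21.
have [w eE' vw] := adj_other ve.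
rewrite /g; case: pickP => [d|/(_ w)] /=.
  rewrite in_setD1 => /andP[dv]; rewrite eE in_set2 (negbTE dv) /= => /eqP->//.
by rewrite in_setD1 eE' set22 eq_sym vw.
Qed.

Lemma refutation_size Delta q : (forall v, #|inc v| <= Delta) ->
  18 * q + 18 * Delta + 24 < treewidth G ->
  exists i, 2 ^ q <= (dnnf_size (Sg i)).+2.
Proof.
(* [l0] pays for [v1] and [v2], for 2q branchings and for at most 2 * Delta terminals; [l] is what
   [unsaturated_vnode] asks for, and 3l is 18q + 18 * Delta + 24. *)
move=> leD ltw; pose l0 := 2 + 2 * q + 2 * Delta; pose l := 3 * l0 + 2.
have [unsat compiled] := refuted.
have [beta hb] : exists beta, @haven G l beta.
  by apply: treewidth_haven; apply: leq_ltn_trans ltw; rewrite /l /l0; lia.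
have [j [k [same [aj ajE] [ak akE] dis]]] :=
  conflicting_apply applyP compiled unsat tseitin_clause_sat.
have [H1 H1F H1E] := compiled_subset applyP compiled j.
have [H2 H2F H2E] := compiled_subset applyP compiled k.
have [v1 [x1 near1]] := exists_near_model connG unsat H1F (proj1 (H1E aj) ajE).
have [v2 [x2 near2]] := exists_near_model connG unsat H2F (proj1 (H2E ak) akE).
have unsat12 x : ~ (cnf_sat x H1 /\ cnf_sat x H2).
  by rewrite -H1E -H2E; exact: dis.
have l0_gt0 : 0 < l0 by rewrite /l0; lia.
have [t tT unsaturated] :=
  unsaturated_vnode hb l0_gt0 (leqnn _) (graft_full (vtree_of (Sg j))).
pose Y := [set e in vvars t]; pose S := [set v1; v2].
have leS : #|S| + 2 * q + #|terminals v1 v2| <= l0.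
  have cS : #|S| <= 2 by rewrite cards2; case: (_ != _).
  have cT : #|terminals v1 v2| <= 2 * Delta.
    have -> : terminals v1 v2 = [set u | @adj G v1 u] :|: [set u | @adj G v2 u].
      by apply/setP => u; rewrite !inE.
    rewrite cardsU mul2n -addnn; apply: leq_trans (leq_subr _ _) _.
    by apply: leq_add; apply: leq_trans (adj_card _) _.
  by rewrite /l0 !leq_add.
have lt_l0 : l0 < l by rewrite /l; lia.
have [|M1 [M2 [cM [fM1 fM2] fool1 fool2]]] :=
  fooling_pair connG hb H1F H2F unsat12 unsaturated lt_l0 (set21 v1 v2) (set22 v1 v2)
    leS near1 near2.
  by move=> s; rewrite in_set2 => /orP[]/eqP->; rewrite eqxx.
have bound (D : strdnnf (edge G)) H v x M : (forall a, accepts D a <-> cnf_sat a H) -> H \subset tseitin c ->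
    same_vtree (vtree_of (Sg j)) (vtree_of D) -> near_family c H v x S M -> fooling Y H M ->
    #|M| <= (dnnf_size D).+2.
  move=> DE HF sameD fM foolM.
  apply: (fooling_set_size (decomposes_along_graft sameD tT)) => [y yM|y z yM zM yz].
    by rewrite DE; have [ny _] := fM y yM; exact: near_model_sat ny.
  by rewrite !DE; apply: foolM.
have leM1 := bound _ _ _ _ _ H1E H1F (same_vtree_refl _) fM1 fool1.
have leM2 := bound _ _ _ _ _ H2E H2F same fM2 fool2.
have [le1|lt1] := leqP (2 ^ q) #|M1|; first by exists j; apply: leq_trans leM1.
have [le2|lt2] := leqP (2 ^ q) #|M2|; first by exists k; apply: leq_trans leM2.
have := ltn_mul lt1 lt2.
by rewrite -expnD addnn -mul2n ltnNge cM.
Qed.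

Lemma refutation_pow_size Delta : (forall v, #|inc v| <= Delta) ->
  exists i p, treewidth G <= (18 * Delta + 78) * p /\ 2 ^ p <= dnnf_size (Sg i).
Proof.
move=> leD; have [le_tw|lt_tw] := leqP (treewidth G) (18 * Delta + 78).
  by have [i lei] := nontrivial_circuit; exists i, 1; rewrite muln1.
move: lt_tw (@refutation_size Delta); move: (treewidth G) => k lt_k bound.
(* The largest admissible [q]; since k exceeds 18 * Delta + 24 + 18 * 3, it is at least 3. *)
have [q [q3 lt_q le_q]] : exists q,
    [/\ 3 <= q, 18 * q + 18 * Delta + 24 < k & k <= 18 * q.+1 + 18 * Delta + 24].
  by exists ((k - (18 * Delta + 25)) %/ 18); split; lia.
(* Passing to [q.-1] absorbs the additive 2 in the size bound, as 2^q - 2 is at least 2^(q-1). *)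
have [i lei] := bound q leD lt_q; exists i, q.-1; split; first by nia.
case: q q3 lei {lt_q le_q} => [|[|q]] // _; rewrite !expnS /=.
have := expn_gt0 2 q; lia.
Qed.

End Refutation.

Import Order.TTheory GRing.Theory Num.Theory.
Local Open Scope ring_scope.

Theorem theorem1 (R : realType) (Delta : nat) (cG : mgraph -> Prop)
  (hDelta : forall G : mgraph, cG G -> (max_degree G <= Delta)%N) :
  exists (alpha : R) (b : nat), 0 < alpha /\
    forall G : mgraph, cG G -> connected_graph G ->
    forall (c : charge G) (n : nat), n = #|cnf_vars (tseitin c)| -> (1 < n)%N ->
    forall apply : strdnnf (edge G) -> strdnnf (edge G) -> strdnnf (edge G),
      is_apply apply ->
    forall (N : nat) (Sg : 'I_N.+1 -> strdnnf (edge G)),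
      refutation apply (tseitin c) Sg ->
    exists i : 'I_N.+1,
      2 `^ (alpha * (treewidth G)%:R) * (n%:R^-1) ^+ b
        <= (dnnf_size (Sg i))%:R.
Proof.
(* With [b] equal to 0, no polynomial factor in n is lost. *)
exists (18 * Delta + 78)%N%:R^-1, 0%N; split.
  by rewrite invr_gt0 ltr0n addn_gt0 orbT.
move=> G GG connG c n nE n1 apply applyP N Sg ref.
have edges2 : (1 < #|edge G|)%N by apply: leq_trans n1 _; rewrite nE max_card.
have leD (v : vert G) : (#|inc v| <= Delta)%N.
  by apply: leq_trans (hDelta G GG); rewrite /max_degree (bigD1 v) //= leq_maxl.
have [i [p [le_tw le_size]]] := refutation_pow_size connG edges2 applyP ref leD.
exists i; rewrite expr0 mulr1; apply: (@le_trans _ _ (2 `^ p%:R)); last first.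
  by rewrite powR_mulrn ?ler0n // -natrX ler_nat.
apply: ler_powR; first by rewrite ler1n.
by rewrite mulrC ler_pdivrMr ?ltr0n ?addn_gt0 ?orbT // -natrM ler_nat mulnC.
Qed.
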